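(* Let $2\le k\le n-2$, let $e_I$ be a vertex of $\Delta_{k,n}$ (so $I\subset\{1,\ldots,n\}$, $|I|=k$), and fix an $n$-cycle, say without loss of generality $\sigma=(1,2,\ldots,n)$. Let $\ell$ be the number of cyclic intervals in $I$. Then the translated blade $((1,2,\ldots,n))_{e_I}$ induces a multi-split matroid subdivision of $\Delta_{k,n}$, with $\ell$ maximal cells, that is trivial precisely when the subset $I$ coincides with a cyclic interval in $\{1,\ldots,n\}$: $$((1,2,\ldots,n))_{e_I}\cap\Delta_{k,n}=(((S_1)_{s_1},(S_2)_{s_2},\ldots,(S_\ell)_{s_\ell}))\cap\Delta_{k,n},$$ where $((S_1)_{s_1},\ldots,(S_\ell)_{s_\ell})\in\mathrm{OSP}(\Delta_{k,n})$ is constructed explicitly as follows: up to cyclic rotation write $(1,2,\ldots,n)$ as the concatenation $(C_1,I_1,C_2,I_2,\ldots,C_\ell,I_\ell)$, where $I_1,\ldots,I_\ell$ are the cyclic intervals of $I$ and $C_1,\ldots,C_\ell$ are the interlaced complementary cyclic intervals, and put $S_j=I_j\cup C_j$ and $s_j=|I_j|$. In particular, the blade induces the trivial matroid subdivision if and only if $I$ is a cyclic interval (i.e. $\ell=1$).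
   Context: Notation. For a set $J\subseteq\{1,\ldots,n\}$ put $x_J=\sum_{j\in J}x_j$ and $e_J=\sum_{j\in J}e_j$. $\mathcal H_{k,n}=\{x\in\mathbb R^n:\sum_i x_i=k\}$ and $\Delta_{k,n}=\{x\in[0,1]^n:\sum_i x_i=k\}$. Decorated ordered set partitions. A decorated ordered set partition $((S_1)_{s_1},\ldots,(S_\ell)_{s_\ell})$ of $(\{1,\ldots,n\},k)$ is an ordered set partition $(S_1,\ldots,S_\ell)$ of $\{1,\ldots,n\}$ with integers $s_j$ satisfying $\sum_j s_j=k$. It belongs to $\mathrm{OSP}(\Delta_{k,n})$ if moreover $1\le s_j\le |S_j|-1$ for all $j$. Denote by $[(S_1)_{s_1},\ldots,(S_\ell)_{s_\ell}]$ the polyhedral cone in $\mathcal H_{k,n}$ given by $x_{S_1\cup\cdots\cup S_m}\ge s_1+\cdots+s_m$ for $m=1,\ldots,\ell-1$. Blades. The blade $(((S_1)_{s_1},\ldots,(S_\ell)_{s_\ell}))$ is the union over $j=1,\ldots,\ell$ of the boundaries, relative to $\mathcal H_{k,n}$, of the cones $[(S_j)_{s_j},(S_{j+1})_{s_{j+1}},\ldots,(S_{j-1})_{s_{j-1}}]$ (cyclic block rotations; these $\ell$ cones form a complete fan in $\mathcal H_{k,n}$). When all $s_j=0$ the subscripts are omitted; so $((1,2,\ldots,n))\subset\mathcal H_{0,n}$ is the blade with singleton blocks $\{1\},\ldots,\{n\}$ and all $s_i=0$. For $p\in\mathbb R^n$, $((1,2,\ldots,n))_p$ is its translate by $p$.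 Induced subdivision. A blade (or translated blade) in $\mathcal H_{k,n}$ induces the subdivision of $\Delta_{k,n}$ whose maximal cells are the $(n-1)$-dimensional intersections of $\Delta_{k,n}$ with the (translated) cones above. It is trivial if $\Delta_{k,n}$ is its only maximal cell. A matroid polytope in $\Delta_{k,n}$ is the convex hull of the $e_B$, $B$ running over the bases of a rank $k$ matroid on $\{1,\ldots,n\}$; a matroid subdivision is a polytopal subdivision all of whose maximal cells are matroid polytopes. A $d$-split ($d\ge1$) of an $m$-dimensional polytope $P$ is a coarsest subdivision $P=P_1\cup\cdots\cup P_d$ into $m$-dimensional polytopes that intersect only on their common facets, with $\mathrm{codim}(P_1\cap\cdots\cap P_d)=d-1$; a multi-split is a $d$-split for some unspecified $d$. The cyclic intervals of $I$ are the maximal subsets of $I$ that are consecutive in the cyclic order $1,2,\ldots,n,1$; $I$ is a cyclic interval if there is exactly one of them.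
   Formalization: The displayed equality fails as sets (n=4, k=2, I={1,2}: right side empty, left side contains e_I); instead: both blades induce the same subdivision, agree on Δ_{k,n} off its relative boundary, and the right side is contained in the left on all of Δ_{k,n}. *)

(* Defs.v *)
From HB Require Import structures.
From mathcomp Require Import all_boot all_order all_algebra.
From mathcomp Require Import all_classical all_reals all_analysis.

Set Implicit Arguments.
Unset Strict Implicit.
Unset Printing Implicit Defensive.

Import Order.TTheory GRing.Theory Num.Theory.
Import numFieldNormedType.Exports.

Local Open Scope classical_set_scope.
Local Open Scope ring_scope.

Definition evec (R : realType) (n : nat) (J : {set 'I_n}) : 'rV[R]_n :=
  \row_j (j \in J)%:R.

Definition xsum (R : realType) (n : nat) (x : 'rV[R]_n) (J : {set 'I_n}) : R :=
  \sum_(j in J) x 0 j.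

Definition hyperplane (R : realType) (n : nat) (k : int) : set 'rV[R]_n :=
  [set x | \sum_i x 0 i = k%:~R].
Arguments hyperplane : clear implicits.

Definition hypersimplex (R : realType) (n k : nat) : set 'rV[R]_n :=
  [set x | (forall i, 0 <= x 0 i <= 1) /\ \sum_i x 0 i = k%:R].
Arguments hypersimplex : clear implicits.

Definition translate (R : realType) (n : nat) (p : 'rV[R]_n)
    (A : set 'rV[R]_n) : set 'rV[R]_n :=
  [set x + p | x in A].

(* Topological boundary, in the subspace H, of a subset A of H. *)
Definition rel_boundary (R : realType) (n : nat) (H A : set 'rV[R]_n) :
    set 'rV[R]_n :=
  H `&` closure A `&` closure (H `\` A).

Definition conv_hull (R : realType) (n : nat) (A : set 'rV[R]_n) :
    set 'rV[R]_n :=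
  [set x | exists (m : nat) (w : 'I_m -> R) (a : 'I_m -> 'rV[R]_n),
     [/\ forall i, 0 <= w i, \sum_i w i = 1, forall i, A (a i)
       & x = \sum_i w i *: a i]].

Definition is_polytope (R : realType) (n : nat) (P : set 'rV[R]_n) : Prop :=
  exists A : set 'rV[R]_n, finite_set A /\ P = conv_hull A.

(* The affine hull of A has dimension m: the affinely independent points
   p, p + D_1, ..., p + D_m of A affinely span A.  The empty set has no
   dimension. *)
Definition has_dim (R : realType) (n : nat) (A : set 'rV[R]_n) (m : nat) :
    Prop :=
  exists (p : 'rV[R]_n) (D : 'M[R]_(m, n)),
    [/\ A p, row_free D, forall i, A (p + row i D)
      & forall x, A x -> (x - p <= D)%MS].

(* The empty face (c = 0, b = 1) and P itself (c = 0, b = 0) are included. *)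
Definition is_face (R : realType) (n : nat) (F P : set 'rV[R]_n) : Prop :=
  exists (c : 'I_n -> R) (b : R),
    (forall x, P x -> \sum_i c i * x 0 i <= b) /\
    F = P `&` [set x | \sum_i c i * x 0 i = b].

Definition is_facet (R : realType) (n : nat) (F P : set 'rV[R]_n) : Prop :=
  is_face F P /\ exists m : nat, has_dim P m.+1 /\ has_dim F m.

Definition is_subdivision (R : realType) (n : nat) (P : set 'rV[R]_n)
    (Sigma : set (set 'rV[R]_n)) : Prop :=
  [/\ finite_set Sigma,
      exists m, has_dim P m /\
        forall Q, Sigma Q -> is_polytope Q /\ has_dim Q m,
      \bigcup_(Q in Sigma) Q = P
    & forall Q Q', Sigma Q -> Sigma Q' ->
        is_face (Q `&` Q') Q /\ is_face (Q `&` Q') Q'].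

Definition trivial_subdivision (R : realType) (n : nat) (P : set 'rV[R]_n)
    (Sigma : set (set 'rV[R]_n)) : Prop :=
  Sigma = [set P].

Definition refines (R : realType) (n : nat)
    (Sigma Sigma' : set (set 'rV[R]_n)) : Prop :=
  forall Q, Sigma Q -> exists2 Q', Sigma' Q' & Q `<=` Q'.

(* Coarsest among the nontrivial subdivisions; the trivial subdivision also
   qualifies, so that it is a 1-split. *)
Definition is_coarsest (R : realType) (n : nat) (P : set 'rV[R]_n)
    (Sigma : set (set 'rV[R]_n)) : Prop :=
  is_subdivision P Sigma /\
  forall Sigma', is_subdivision P Sigma' -> refines Sigma Sigma' ->
    trivial_subdivision P Sigma' \/ Sigma' = Sigma.

Definition is_split (R : realType) (n : nat) (d : nat) (P : set 'rV[R]_n)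
    (Sigma : set (set 'rV[R]_n)) : Prop :=
  [/\ (1 <= d)%N,
      is_coarsest P Sigma,
      (Sigma #= `I_d)%card,
      forall Q Q', Sigma Q -> Sigma Q' -> Q <> Q' ->
        is_facet (Q `&` Q') Q /\ is_facet (Q `&` Q') Q'
    & exists m r : nat, [/\ has_dim P m,
        has_dim (\bigcap_(Q in Sigma) Q) r & (r + (d - 1))%N = m]].

Definition is_multi_split (R : realType) (n : nat) (P : set 'rV[R]_n)
    (Sigma : set (set 'rV[R]_n)) : Prop :=
  exists d, is_split d P Sigma.

Definition matroid_bases (n k : nat) (B : {set {set 'I_n}}) : Prop :=
  [/\ B != finset.set0,
      forall X, X \in B -> #|X| = k
    & forall X Y, X \in B -> Y \in B -> forall x, x \in X :\: Y ->
        exists2 y, y \in Y :\: X & y |: (X :\ x) \in B].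

Definition is_matroid_polytope (R : realType) (n k : nat)
    (P : set 'rV[R]_n) : Prop :=
  exists B : {set {set 'I_n}}, matroid_bases k B /\
    P = conv_hull [set evec R X | X in [set` B]].

Definition is_matroid_subdivision (R : realType) (n k : nat)
    (Sigma : set (set 'rV[R]_n)) : Prop :=
  is_subdivision (hypersimplex R n k) Sigma /\
  forall Q, Sigma Q -> is_matroid_polytope k Q.

(* ((S_1)_{s_1}, ..., (S_l)_{s_l}) is the list of the pairs (S_j, s_j). *)
Definition decorated (n : nat) := seq ({set 'I_n} * int).

Definition is_dosp (n : nat) (k : int) (d : decorated n) : Prop :=
  [/\ uniq [seq p.1 | p <- d],
      finset.partition [set S in [seq p.1 | p <- d]]%SET [set: 'I_n]%SET
    & \sum_(p <- d) p.2 = k].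

(* Membership in OSP(Delta_{k,n}). *)
Definition OSP (n k : nat) (d : decorated n) : Prop :=
  is_dosp k%:Z d /\
  forall p, p \in d -> 1 <= p.2 /\ p.2 <= #|p.1|%:Z - 1.

Definition cone (R : realType) (n : nat) (k : int) (d : decorated n) :
    set 'rV[R]_n :=
  [set x | hyperplane R n k x /\
     forall m : nat, (0 < m < size d)%N ->
       (\sum_(p <- take m d) p.2)%:~R
         <= xsum x (\bigcup_(p <- take m d) p.1)%SET].
Arguments cone R {n} k d.

Definition blade_cones (R : realType) (n : nat) (k : int) (d : decorated n) :
    set (set 'rV[R]_n) :=
  [set cone R k (rot j d) | j in `I_(size d)].
Arguments blade_cones R {n} k d.

Definition blade (R : realType) (n : nat) (k : int) (d : decorated n) :
    set 'rV[R]_n :=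
  \bigcup_(C in blade_cones R k d) rel_boundary (hyperplane R n k) C.
Arguments blade R {n} k d.

(* For sigma listing the n-cycle (sigma_1, ..., sigma_n), the singleton blocks
   {sigma_1}, ..., {sigma_n} with all decorations 0; the corresponding blade
   lies in the hyperplane of coordinate sum 0. *)
Definition singletons (n : nat) (sigma : seq 'I_n) : decorated n :=
  [seq ([set i]%SET, 0) | i <- sigma].

Definition translated_blade (R : realType) (n : nat) (sigma : seq 'I_n)
    (p : 'rV[R]_n) : set 'rV[R]_n :=
  translate p (blade R 0 (singletons sigma)).

Definition translated_cones (R : realType) (n : nat) (sigma : seq 'I_n)
    (p : 'rV[R]_n) : set (set 'rV[R]_n) :=
  [set translate p C | C in blade_cones R 0 (singletons sigma)].

(* Maximal cells of the subdivision of P induced by a family of cones: the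
   intersections with P that have the dimension of P. *)
Definition induced_subdivision (R : realType) (n : nat) (P : set 'rV[R]_n)
    (cones : set (set 'rV[R]_n)) : set (set 'rV[R]_n) :=
  [set P `&` C | C in [set C | cones C /\ has_dim (P `&` C) (n - 1)]].

(* Nonempty sets of elements that are consecutive in the cyclic order sigma. *)
Definition consecutive (n : nat) (sigma : seq 'I_n) (J : {set 'I_n}) : bool :=
  [exists r : 'I_n, exists m : 'I_n,
     J == [set i in take m.+1 (rot r sigma)]%SET].

Definition cyclic_intervals (n : nat) (sigma : seq 'I_n) (I : {set 'I_n}) :
    {set {set 'I_n}} :=
  [set J | maxset (fun K => (K \subset I) && consecutive sigma K) J]%SET.

Definition is_cyclic_interval (n : nat) (sigma : seq 'I_n) (I : {set 'I_n}) :
    Prop :=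
  #|cyclic_intervals sigma I| = 1%N.

(* CI lists the pairs (C_1, I_1), ..., (C_l, I_l), each C_j and I_j being
   itself listed in the cyclic order: up to rotation, sigma is the
   concatenation C_1 I_1 ... C_l I_l. *)
Definition interlacing (n : nat) (sigma : seq 'I_n) (I : {set 'I_n})
    (CI : seq (seq 'I_n * seq 'I_n)) : Prop :=
  [/\ exists r : nat, rot r sigma = flatten [seq p.1 ++ p.2 | p <- CI],
      perm_eq [seq [set i in p.2]%SET | p <- CI]
              (enum (cyclic_intervals sigma I))
    & perm_eq [seq [set i in p.1]%SET | p <- CI]
              (enum (cyclic_intervals sigma (~: I)%SET))].

(* S_j = I_j \cup C_j and s_j = #|I_j|. *)
Definition interlaced_dosp (n : nat) (CI : seq (seq 'I_n * seq 'I_n)) :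
    decorated n :=
  [seq (([set i in p.2] :|: [set i in p.1])%SET,
        #|[set i in p.2]%SET|%:Z) | p <- CI].

(* Main.v *)
(* For y in the hypersimplex let f(y, t) be the sum of y - e_I over the first t
   elements of the cycle, a function on Z/n.  The t-th cone of the translated
   blade is the set of y for which t minimizes f(y, .), and the t-th cone of
   the blade with blocks S_1, ..., S_l is the same with t and the competitors
   restricted to the starts of the blocks.  As f(y, .) increases along the
   complementary intervals C_j and decreases along the I_j, its minimum is
   attained at the start of some C_j, and at another t only if a coordinate of
   y is 0 or 1.  Hence both fans cut out the same full-dimensional cells.

   Each cell is the polytope of the matroid whose bases dominate I in the Gale
   order for a rotation of the cycle.  A coarsening of the subdivision is
   trivial or equal to it, because the faces along which its cells meet lie in
   the hyperplanes where two block starts tie. *)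
Require Import Defs.
From HB Require Import structures.
From mathcomp Require Import all_boot all_order all_algebra.
From mathcomp Require Import all_classical all_reals all_analysis.
From mathcomp Require Import zify ring lra.

Set Implicit Arguments.
Unset Strict Implicit.
Unset Printing Implicit Defensive.

Import Order.TTheory GRing.Theory Num.Theory.
Import numFieldNormedType.Exports.

Local Open Scope classical_set_scope.
Local Open Scope ring_scope.

(** * Dimension and subdivisions *)

(** The two blades cannot agree on all of the hypersimplex. At y = e_I every f(y, t) vanishes, so
    all t tie and e_I lies on the translated blade; but for a cyclic interval I the single cone of
    the other blade is the whole hyperplane, with empty boundary. Hence equality is proved off the
    relative boundary of the hypersimplex, and one inclusion everywhere.

    All dimensions come from one construction: for any nonempty set A of block indices there is a
    point with coordinates strictly between 0 and 1 whose potential is minimal exactly on A. It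
    exists because 1 <= s_j <= |S_j| - 1 leaves a unit of room on both sides of s_j, of which at
    most half is used. Around that point a cell is constrained by its ties and the coordinate sum
    alone. *)

Definition lform (R : realType) (n : nat) (c : 'I_n -> R) (x : 'rV[R]_n) : R :=
  \sum_i c i * x 0 i.

Lemma lformD (R : realType) n (c : 'I_n -> R) x y :
  lform c (x + y) = lform c x + lform c y.
Proof.
by rewrite /lform -big_split; apply: eq_bigr => i _; rewrite mxE mulrDr.
Qed.

Lemma lformZ (R : realType) n (c : 'I_n -> R) t x :
  lform c (t *: x) = t * lform c x.
Proof.
by rewrite /lform mulr_sumr; apply: eq_bigr => i _; rewrite mxE mulrCA.
Qed.

Lemma lformB (R : realType) n (c : 'I_n -> R) x y :
  lform c (x - y) = lform c x - lform c y.
Proof. by rewrite -scaleN1r lformD lformZ mulN1r. Qed.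

Lemma lform_sum (R : realType) n (c : 'I_n -> R) (J : finType)
    (F : J -> 'rV[R]_n) :
  lform c (\sum_j F j) = \sum_j lform c (F j).
Proof.
rewrite /lform exchange_big; apply: eq_bigr => i _.
by rewrite summxE mulr_sumr.
Qed.

Lemma lform_mx (R : realType) n (c : 'I_n -> R) (x : 'rV[R]_n) :
  lform c x = (x *m \col_i c i) 0 0.
Proof. by rewrite mxE; apply: eq_bigr => i _; rewrite mxE mulrC. Qed.

(** Inclusion with equal dimension makes the two affine hulls equal, and the form is constant on the
    hull of [A]. *)
Lemma lform_eq_span (R : realType) (n m : nat) (A B : set 'rV[R]_n)
    (c : 'I_n -> R) (b : R) :
  has_dim A m -> has_dim B m -> A `<=` B ->
  (forall x, A x -> lform c x = b) -> forall x, B x -> lform c x = b.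
Proof.
move=> [p [D [Ap Dfree AD _]]] [p' [D' [Bp' Dfree' BD' Bsp']]] AB cA x Bx.
have sub_diff y z : B y -> B z -> (y - z <= D')%MS.
  move=> By Bz; have -> : y - z = (y - p') - (z - p').
    by rewrite opprB addrA subrK.
  by rewrite addmx_sub ?eqmx_opp ?Bsp'.
have DD' : (D <= D')%MS.
  apply/row_subP => i; have := sub_diff _ _ (AB _ (AD i)) (AB _ Ap).
  by rewrite addrC addKr.
have D'D : (D' <= D)%MS.
  have /leqifP := mxrank_leqif_sup DD'.
  by rewrite (eqP Dfree) (eqP Dfree'); case: ifP => //; rewrite ltnn.
have /submxP [u xp] := submx_trans (sub_diff _ _ Bx (AB _ Ap)) D'D.
have D0 : D *m (\col_i c i) = 0.
  apply/row_matrixP => i; rewrite row_mul row0; apply/rowP => j.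
  rewrite ord1 -lform_mx mxE.
  by have := cA _ (AD i); rewrite lformD (cA _ Ap) -{2}(addr0 b) => /addrI.
have : lform c (x - p) = 0 by rewrite lform_mx xp -mulmxA D0 mulmx0 mxE.
by rewrite lformB (cA _ Ap) => /subr0_eq.
Qed.

Lemma sum_lform (R : realType) n (x : 'rV[R]_n) :
  \sum_i x 0 i = lform (fun=> 1) x.
Proof. by apply: eq_bigr => i _; rewrite mul1r. Qed.

Lemma conv_hull_convex (R : realType) (n : nat) (A : set 'rV[R]_n) x y t :
  conv_hull A x -> conv_hull A y -> 0 <= t <= 1 ->
  conv_hull A (t *: x + (1 - t) *: y).
Proof.
move=> [m1 [w1 [a1 [w1_ge0 w1_1 Aa1 ->]]]] [m2 [w2 [a2 [w2_ge0 w2_1 Aa2 ->]]]].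
move=> /andP [t0 t1].
exists (m1 + m2)%N.
exists (fun i => match fintype.split i with inl j => t * w1 j
                                   | inr j => (1 - t) * w2 j end).
exists (fun i => match fintype.split i with inl j => a1 j | inr j => a2 j end).
split.
- by move=> i; case: fintype.split => j; rewrite mulr_ge0 ?subr_ge0.
- rewrite big_split_ord /=.
  under eq_bigr => i _ do rewrite (unsplitK (inl i)).
  under [X in _ + X]eq_bigr => i _ do rewrite (unsplitK (inr i)).
  by rewrite -!mulr_sumr w1_1 w2_1 !mulr1 addrC subrK.
- by move=> i; case: fintype.split.
- rewrite big_split_ord /=.
  under [X in _ = X + _]eq_bigr => i _ do rewrite (unsplitK (inl i)) -scalerA.
  under [X in _ = _ + X]eq_bigr => i _ do rewrite (unsplitK (inr i)) -scalerA.
  by rewrite -!scaler_sumr.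
Qed.

Lemma sub_conv_hull (R : realType) (n : nat) (A : set 'rV[R]_n) :
  A `<=` conv_hull A.
Proof.
move=> x Ax; exists 1%N, (fun=> 1), (fun=> x); split=> //.
- by rewrite big_ord1.
- by rewrite big_ord1 scale1r.
Qed.

Lemma polytope_convex (R : realType) (n : nat) (P : set 'rV[R]_n) x y t :
  is_polytope P -> P x -> P y -> 0 <= t <= 1 -> P (t *: x + (1 - t) *: y).
Proof. by move=> [A [_ ->]]; apply: conv_hull_convex. Qed.

Lemma polytope_barycenter (R : realType) (n m : nat) (P : set 'rV[R]_n)
    (a : 'I_m.+1 -> 'rV[R]_n) :
  is_polytope P -> (forall i, P (a i)) ->
  P (m.+1%:R^-1 *: \sum_i a i).
Proof.
move=> polP; elim: m a => [|m IHm] a Pa.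
  by rewrite big_ord1 invr1 scale1r.
rewrite big_ord_recr /=.
pose t : R := m.+1%:R / m.+2%:R.
have m2 : (m.+2%:R : R) = m.+1%:R + 1 by rewrite -natr1.
have m1_gt0 : 0 < m.+1%:R :> R by rewrite ltr0n.
have := polytope_convex (t := t) polP
  (IHm (fun i => a (widen_ord (leqnSn m.+1) i)) (fun i => Pa _)) (Pa ord_max).
have -> : 1 - t = m.+2%:R^-1 by rewrite /t m2; field; rewrite gt_eqF // addr_gt0.
rewrite scalerA.
have -> : t / m.+1%:R = m.+2%:R^-1.
  by rewrite /t m2; field; rewrite !gt_eqF // addr_gt0.
rewrite -scalerDr; apply; rewrite divr_ge0 ?ler0n //= ler_pdivrMr ?ltr0n //.
by rewrite mul1r ler_nat.
Qed.

(** The nonnegative gaps [b - lform c (a i)] sum to zero, so each vanishes: a face through the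
    barycenter contains every point. *)
Lemma barycenter_face (R : realType) (n m : nat) (a : 'I_m.+1 -> 'rV[R]_n)
    (c : 'I_n -> R) (b : R) :
  (forall i, lform c (a i) <= b) ->
  lform c (m.+1%:R^-1 *: \sum_i a i) = b ->
  forall i, lform c (a i) = b.
Proof.
move=> le_b; rewrite lformZ lform_sum => eq_b.
have sum0 : \sum_i (b - lform c (a i)) = 0.
  rewrite sumrB sumr_const card_ord -eq_b -mulrnAl -[_ *+ m.+1]mulr_natl divff.
    by rewrite mul1r subrr.
  by rewrite pnatr_eq0.
move=> i; have := sum0 => /eqP; rewrite psumr_eq0; last first.
  by move=> j _; rewrite subr_ge0.
by move=> /allP /(_ i (mem_index_enum _)) /= ; rewrite subr_eq0 => /eqP.
Qed.

(** The common face is [Q] itself and has the dimension of [Q'], so the form that cuts it out is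
    constant on [Q'] and the face is all of [Q']. *)
Lemma subdivision_maximal (R : realType) (n : nat) (P : set 'rV[R]_n)
    (S : set (set 'rV[R]_n)) Q Q' :
  is_subdivision P S -> S Q -> S Q' -> Q `<=` Q' -> Q = Q'.
Proof.
move=> [_ [m [_ dimS]] _ facS] SQ SQ' QQ'.
have [_ [c [b [_ eqQ]]]] := facS _ _ SQ SQ'.
apply/seteqP; split=> // x Q'x.
have eqb : forall y, Q y -> lform c y = b.
  move=> y Qy; have : (Q `&` Q') y by split=> //; apply: QQ'.
  by rewrite eqQ => -[].
have := lform_eq_span (dimS _ SQ).2 (dimS _ SQ').2 QQ' eqb Q'x => cx.
by have [] : (Q `&` Q') x by rewrite eqQ.
Qed.

(** The barycenter [z] of an affine basis of [Q] is relatively interior. A cell of [S'] through [z]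
    meets [Q] in a face containing [z], which can only be [Q]; maximality then identifies the two
    cells. *)
Lemma subdivision_cover (R : realType) (n : nat) (P : set 'rV[R]_n)
    (S S' : set (set 'rV[R]_n)) :
  is_subdivision P S -> S' `<=` S -> P `<=` \bigcup_(Q in S') Q -> S = S'.
Proof.
move=> subS S'S covP; have [_ [m [_ dimS]] unP facS] := subS.
apply/seteqP; split=> // Q SQ.
have [polQ [p [D [Qp _ QD Qsp]]]] := dimS _ SQ.
pose a (i : 'I_m.+1) := if unlift ord0 i is Some j then p + row j D else p.
have Qa i : Q (a i) by rewrite /a; case: unliftP.
set z := m.+1%:R^-1 *: \sum_i a i.
have Qz : Q z by apply: polytope_barycenter.
have [Q' S'Q' Q'z] : (\bigcup_(Q in S') Q) z.
  by apply: covP; rewrite -unP; exists Q.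
suff QQ' : Q `<=` Q' by rewrite (subdivision_maximal subS SQ (S'S _ S'Q') QQ').
have [[c [b [le_b eqQ]]] _] := facS _ _ SQ (S'S _ S'Q').
have cz : lform c z = b.
  by have : (Q `&` Q') z by []; rewrite eqQ => -[].
have ca := barycenter_face (fun i => le_b _ (Qa i)) cz.
move=> x Qx; suff cx : lform c x = b.
  by have [] : (Q `&` Q') x by rewrite eqQ.
have cp : lform c p = b by have := ca ord0; rewrite /a unlift_none.
have cD i : lform c (row i D) = 0.
  have := ca (lift ord0 i); rewrite /a liftK lformD cp -{2}(addr0 b).
  exact: addrI.
have /submxP [u xp] := Qsp _ Qx.
have : lform c (x - p) = 0.
  rewrite lform_mx xp -mulmxA (_ : D *m _ = 0) ?mulmx0 ?mxE //.
  apply/row_matrixP => i; rewrite row_mul row0; apply/rowP => j.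
  by rewrite ord1 -lform_mx mxE.
by rewrite lformB cp => /subr0_eq.
Qed.

(** * Dimension of sets that locally fill a space of vectors with zero fiber sums *)

Section Fibers.
Context (R : realType) (n : nat) (T : finType) (pi : 'I_n -> T).

Definition fiber_mx : 'M[R]_(n, #|T|) :=
  \matrix_(i, j) (pi i == enum_val j)%:R.

Lemma mul_fiber_mx (v : 'rV[R]_n) j :
  (v *m fiber_mx) 0 j = \sum_(i | pi i == enum_val j) v 0 i.
Proof.
rewrite mxE [RHS]big_mkcond; apply: eq_bigr => i _; rewrite mxE.
by case: eqP; rewrite ?mulr1 ?mulr0.
Qed.

Lemma sub_ker_fiber_mx (v : 'rV[R]_n) :
  (v <= kermx fiber_mx)%MS <-> forall t, \sum_(i | pi i == t) v 0 i = 0.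
Proof.
split=> [/sub_kermxP vM t | v0].
  by have := mul_fiber_mx v (enum_rank t); rewrite vM mxE enum_rankK.
apply/sub_kermxP/rowP => j; rewrite mul_fiber_mx v0 mxE //.
Qed.

(** Selecting one representative per fiber gives a left inverse of [fiber_mx], which therefore has
    rank [#|T|]. *)
Lemma rank_ker_fiber_mx :
  (forall t, exists i, pi i = t) -> \rank (kermx fiber_mx) = (n - #|T|)%N.
Proof.
move=> surj; rewrite mxrank_ker; congr (_ - _)%N; apply/eqP/row_fullP.
have [s sK] := choice surj.
exists (\matrix_(j, i) (s (enum_val j) == i)%:R).
apply/matrixP => j j'; rewrite !mxE (bigD1 (s (enum_val j))) //= !mxE eqxx sK.
rewrite mul1r big1 ?addr0 => [|i /negPf ni].
  by rewrite (inj_eq enum_val_inj).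
by rewrite !mxE eq_sym ni mul0r.
Qed.

(** [A] lies in the translate through [p] of the space of vectors with zero fiber sums and contains
    a box around [p] in it, so a small multiple of a basis of that space serves as direction
    matrix. *)
Lemma has_dim_fibers (A : set 'rV[R]_n) (p : 'rV[R]_n) (e : R) :
  (forall t, exists i, pi i = t) -> 0 < e ->
  (forall x, A x -> forall t, \sum_(i | pi i == t) (x - p) 0 i = 0) ->
  (forall x, (forall t, \sum_(i | pi i == t) (x - p) 0 i = 0) ->
     (forall i, `|(x - p) 0 i| <= e) -> A x) ->
  has_dim A (n - #|T|).
Proof.
move=> surj e0 Asp Aloc; rewrite -(rank_ker_fiber_mx surj).
set V := kermx fiber_mx.
(* Dividing by a bound for all entries of the basis keeps its rows in the box of radius [e]; the
   summand 1 makes [N] positive even for an empty basis. *)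
pose N := 1 + \sum_i \sum_j `|row_base V i j|.
have N_gt0 : 0 < N.
  by rewrite ltr_pwDl //; do 2!(apply: sumr_ge0 => ? _).
have bnd i j : `|row_base V i j| <= N.
  apply: ler_wpDl => //; rewrite (bigD1 i) //= (bigD1 j) //= -addrA.
  rewrite lerDl addr_ge0 //; first by apply: sumr_ge0.
  by apply: sumr_ge0 => ? _; apply: sumr_ge0.
have eN0 : e / N != 0 by rewrite mulf_neq0 ?invr_eq0 ?gt_eqF.
exists p, ((e / N) *: row_base V); split.
- apply: Aloc => [t|i]; last by rewrite subrr mxE normr0 ltW.
  by rewrite big1 // => i _; rewrite subrr mxE.
- by rewrite /row_free mxrank_scale_nz //; exact: row_base_free.
- move=> i; apply: Aloc => [|j].
    apply/sub_ker_fiber_mx; rewrite addrC addKr.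
    apply: submx_trans (row_sub _ _) _.
    by apply: scalemx_sub; rewrite eq_row_base.
  rewrite addrC addKr 2!mxE normrM ger0_norm; last by rewrite ltW // divr_gt0.
  by rewrite mulrAC ler_pdivrMr // ler_wpM2l // ltW.
- move=> x Ax; rewrite (eqmx_scale _ eN0) eq_row_base.
  by apply/sub_ker_fiber_mx; apply: Asp.
Qed.

End Fibers.

(** Differences of points of [A] have zero sum over each of the two fibers [{a}] and its complement,
    so the dimension is at most n - 2. *)
Lemma not_has_dim_facet (R : realType) (n : nat) (A : set 'rV[R]_n)
    (a : 'I_n) (c k : R) :
  (2 <= n)%N -> (forall x, A x -> x 0 a = c /\ \sum_i x 0 i = k) ->
  ~ has_dim A (n - 1).
Proof.
move=> n2 Asp [p [D [Ap Dfree AD _]]].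
pose pi (i : 'I_n) := i == a.
have surj t : exists i, pi i = t.
  case: t; first by exists a; apply: eqxx.
  have : (0 < #|[set~ a]%SET|)%N by rewrite cardsC1 card_ord; lia.
  by case/card_gt0P => i; rewrite !inE => /negPf; exists i.
have DV : (D <= kermx (@fiber_mx R n _ pi))%MS.
  apply/row_subP => i; apply/sub_ker_fiber_mx => t.
  have [xa xs] := Asp _ (AD i); have [pa ps] := Asp _ Ap.
  have v_a : row i D 0 a = 0.
    by move: xa; rewrite mxE pa -[RHS]addr0 => /addrI.
  have v_s : \sum_i0 row i D 0 i0 = 0.
    move: xs; under eq_bigr => j _ do rewrite mxE.
    by rewrite big_split /= ps -[RHS]addr0 => /addrI.
  case: t; rewrite /pi.
    by rewrite (eq_bigl (pred1 a)) ?big_pred1_eq // => j; rewrite eqb_id.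
  rewrite (bigD1 a) //= v_a add0r in v_s; rewrite -[RHS]v_s.
  by apply: eq_bigl => j; rewrite eqbF_neg.
have := mxrankS DV; rewrite (rank_ker_fiber_mx _ surj) card_bool.
by rewrite (eqP Dfree); lia.
Qed.

(** * Cones defined by minimality of a potential *)

Section Potential.
Context (R : realType) (n : nat) (blk : 'I_n -> nat).

Definition lpot (v : 'rV[R]_n) (i : nat) : R :=
  lform (fun a => (blk a < i)%N%:R) v.

(* blk assigns each element the index of its block in an ordered partition; a
   point lies in the i-th cyclically rotated cone when i minimizes its pot. *)
Definition pot (c : nat -> R) (x : 'rV[R]_n) (i : nat) : R :=
  lpot x i - \sum_(j < i) c j.

Lemma lpotE v i : lpot v i = \sum_(a | (blk a < i)%N) v 0 a.
Proof.
rewrite [RHS]big_mkcond; apply: eq_bigr => a _.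
by case: ltnP; rewrite ?mul1r ?mul0r.
Qed.

Lemma lpot_blocks v i :
  lpot v i = \sum_(j < i) \sum_(a | blk a == j) v 0 a.
Proof.
rewrite lpotE (exchange_big_dep (fun a => (blk a < i)%N)) /=; last first.
  by move=> j a _ /eqP ->.
apply: eq_bigr => a lti.
by rewrite (big_pred1 (Ordinal lti)).
Qed.

Lemma lpot_bound (v : 'rV[R]_n) i e :
  (forall a, `|v 0 a| <= e) -> `|lpot v i| <= n%:R * e.
Proof.
move=> ve; apply: le_trans (ler_norm_sum _ _ _) _.
have -> : n%:R * e = \sum_(a < n) e by rewrite sumr_const card_ord mulr_natl.
apply: ler_sum => a _; rewrite normrM ger0_norm ?ler0n //.
case: (_ < _)%N; rewrite ?mul1r ?mul0r //.
exact: le_trans (ve a).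
Qed.

Lemma potB c x y i : pot c x i - pot c y i = lpot (x - y) i.
Proof. by rewrite /pot /lpot lformB; ring. Qed.

Lemma pot_scale c x v t i : pot c (x + t *: v) i = pot c x i + t * lpot v i.
Proof. by rewrite /pot /lpot lformD lformZ; ring. Qed.

Definition bdiff (i j : nat) (a : 'I_n) : R :=
  (blk a < i)%N%:R - (blk a < j)%N%:R.

Lemma lform_bdiff i j v : lform (bdiff i j) v = lpot v i - lpot v j.
Proof. by rewrite /lpot /lform -sumrB; apply: eq_bigr => a _; rewrite mulrBl. Qed.

Definition pot_cone (k : int) (l : nat) (c : nat -> R) (a : nat) :
    set 'rV[R]_n :=
  [set x | hyperplane R n k x /\ forall i, (i < l)%N -> pot c x a <= pot c x i].

Lemma closure_rowP (A : set 'rV[R]_n) x :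
  closure A x <->
  forall e, 0 < e -> exists2 y, A y & forall a, `|x 0 a - y 0 a| < e.
Proof.
split=> [clA e e0 | near_x B].
  have [y [Ay [_ xy]]] := clA _ (nbhsx_ballx x e e0).
  by exists y => // a; have := xy 0 a.
rewrite -nbhs_ballE => -[e /= e0 xB]; have [y Ay xy] := near_x e e0.
exists y; split=> //; apply: xB; split=> // i a.
by rewrite ord1; apply: xy.
Qed.

Lemma rel_boundary_pot_cone k l c a :
  (forall j, (j < l)%N -> exists b, blk b = j) -> (a < l)%N ->
  forall x, rel_boundary (hyperplane R n k) (pot_cone k l c a) x <->
    pot_cone k l c a x /\
    exists i, [/\ (i < l)%N, i != a & pot c x i = pot c x a].
Proof.
move=> surj al x; split.
- move=> [[Hx clK] clC].
  have n_gt0 : 0 < n%:R :> R.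
    by have [b _] := surj _ al; case: n b => [[]//|m _]; rewrite ltr0n.
  (* Up to a constant a potential is a sum of at most n coordinates, so moves below d / (2n) shift
     each potential by at most d / 2 and a difference of two by at most d. *)
  have near_pot (y : 'rV[R]_n) (d : R) : 0 < d ->
      (forall b, `|x 0 b - y 0 b| < d / (2 * n%:R)) ->
      forall i j, `|(pot c x i - pot c x j) - (pot c y i - pot c y j)| <= d.
    move=> d0 xy i j.
    have bnd h : `|lpot (x - y) h| <= d / 2.
      have -> : d / 2 = n%:R * (d / (2 * n%:R)) by field; rewrite gt_eqF.
      by apply: lpot_bound => b; rewrite !mxE ltW.
    have -> : (pot c x i - pot c x j) - (pot c y i - pot c y j)
        = lpot (x - y) i - lpot (x - y) j by rewrite -!(potB c); ring.
    apply: le_trans (ler_normB _ _) _.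
    by have := bnd i; have := bnd j; lra.
  have e_gt0 (d : R) : 0 < d -> 0 < d / (2 * n%:R).
    by move=> d0; rewrite divr_gt0 // mulr_gt0.
  have Kx : pot_cone k l c a x.
    split=> // i il; rewrite leNgt; apply/negP => lt_ia.
    have d0 : 0 < (pot c x a - pot c x i) / 2.
      by rewrite divr_gt0 // subr_gt0.
    have /closure_rowP /(_ _ (e_gt0 _ d0)) [y [_ Ky] xy] := clK.
    have := near_pot _ _ d0 xy a i; have := Ky _ il.
    by rewrite ler_norml; lra.
  split=> //; apply/not_existsP => no_tie.
  have lt_pot i : (i < l)%N -> i != a -> pot c x a < pot c x i.
    move=> il ia; rewrite lt_neqAle (Kx.2 _ il) andbT.
    by apply/eqP => e; apply: (no_tie i).
  (* The starting value 1 keeps [d] positive when there is no other index. *)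
  pose d := \big[Num.min/1]_(i < l | val i != a) (pot c x i - pot c x a).
  have d0 : 0 < d.
    by apply/bigmin_gtP; split=> // i ia; rewrite subr_gt0 lt_pot.
  have /closure_rowP /(_ _ (e_gt0 _ d0)) [y [Hy nKy] xy] := clC.
  apply: nKy; split=> // i il; have [->//|ia] := eqVneq i a.
  have := near_pot _ _ d0 xy i a.
  have : d <= pot c x i - pot c x a.
    exact: (@bigmin_le_cond _ _ _ _ (Ordinal il) (fun i : 'I_l => val i != a)
      (fun i => pot c x i - pot c x a)).
  by rewrite ler_norml; lra.
- move=> [Kx [i [il ia eqi]]]; split; first split.
  + by case: Kx.
  + exact: subset_closure.
  + apply/closure_rowP => e e0.
    have [b bi] := surj _ il; have [b' ba] := surj _ al.
    have bb' : b != b' by apply: contraNneq ia => e'; rewrite -bi e' ba.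
    (* With [b] in block i and [b'] in block a, this direction has sum 0 and lowers the potential at
       i relative to that at a by 1, whichever of i and a is smaller. *)
    pose v : 'rV[R]_n := delta_mx 0 b - delta_mx 0 b'.
    have lv h : lform h v = h b - h b'.
      rewrite lformB; congr (_ - _); rewrite /lform.
        rewrite (bigD1 b) //= big1 ?addr0 ?mxE ?eqxx ?mulr1 // => j /negPf jb.
        by rewrite mxE jb andbF mulr0.
      rewrite (bigD1 b') //= big1 ?addr0 ?mxE ?eqxx ?mulr1 // => j /negPf jb.
      by rewrite mxE jb andbF mulr0.
    exists (x + (e / 2) *: v); last first.
      move=> j; rewrite !mxE.
      rewrite opprD addrA subrr add0r normrN.
      rewrite normrM ger0_norm ?divr_ge0 ?(ltW e0) //.
      rewrite /=; case: (j == b); case: (j == b');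
        by rewrite ?subrr ?subr0 ?sub0r ?normrN ?normr0 ?normr1; lra.
    split.
      have := lv (fun=> 1); rewrite subrr => v0.
      rewrite /hyperplane /= -Kx.1.
      by rewrite !sum_lform lformD lformZ v0 mulr0 addr0.
    move=> [_ /(_ _ il)].
    rewrite !pot_scale eqi lerD2l -subr_ge0 -mulrBr -lform_bdiff lv /bdiff.
    rewrite bi ba !ltnn.
    case: (ltngtP i a) ia => // _ _; rewrite ?subr0 ?sub0r mulr1n; lra.
Qed.

End Potential.

(** * The multi-split of the hypersimplex *)

Section Cells.
Context (R : realType) (n k l : nat) (blk : 'I_n -> nat) (s : nat -> nat).
Hypothesis n_gt0 : (0 < n)%N.
Hypothesis blk_lt : forall a, (blk a < l)%N.
Hypothesis s_bnd :
  forall j, (j < l)%N -> (0 < s j < #|[set a | blk a == j]%SET|)%N.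
Hypothesis s_sum : (\sum_(j < l) s j)%N = k.

Let c (j : nat) : R := (s j)%:R.
Let P (x : 'rV[R]_n) (i : nat) : R := pot blk c x i.

(** One definition covers every face in question: [pred0] gives the hypersimplex, [pred1 a] a
    maximal cell, [pred2 a b] a wall, [predT] the intersection of all cells. *)
Definition cell (A : pred nat) : set 'rV[R]_n :=
  [set x | hypersimplex R n k x /\
     forall a i, (a < l)%N -> (i < l)%N -> A a -> P x a <= P x i].

Lemma blk_surj j : (j < l)%N -> exists b, blk b = j.
Proof.
move=> /s_bnd /andP [_ /(leq_ltn_trans (leq0n _)) /card_gt0P [b]].
by rewrite inE => /eqP; exists b.
Qed.

Lemma l_gt0 : (0 < l)%N.
Proof. exact: leq_ltn_trans (leq0n _) (blk_lt (Ordinal n_gt0)). Qed.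

(** The margin 1/(2n) is half a unit of slack in a block sum, spread over at most n elements. The
    gap 1/2 is what the perturbations in [near_center] may use up. *)
Definition centered (A : pred nat) (w : 'rV[R]_n) : Prop :=
  [/\ forall a, (2 * n%:R)^-1 <= w 0 a <= 1 - (2 * n%:R)^-1,
      \sum_a w 0 a = k%:R
    & forall a i, (a < l)%N -> (i < l)%N -> A a ->
        P w i = P w a + (~~ A i)%:R / 2].

(* Block-constant, with the sum over block j shifted from s_j by 0 or 1/2 so
   that the potential is minimal exactly on A; the integrality of s_j keeps
   the coordinates inside ]0, 1[. *)
Lemma cell_center (A : pred nat) : exists w, centered A w.
Proof.
(* Reducing the index modulo l makes [chi l] equal to [chi 0], so the shifts telescope to zero and
   the total stays k. *)
pose chi i : R := (~~ A (i %% l)%N)%:R / 2.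
have chil : chi l = chi 0%N by rewrite /chi modnn mod0n.
pose m j : R := #|[set a | blk a == j]%SET|%:R.
pose u j : R := (s j)%:R + (chi j.+1 - chi j).
pose w : 'rV[R]_n := \row_a (u (blk a) / m (blk a)).
have m_gt0 j : (j < l)%N -> 0 < m j.
  by move=> /s_bnd /andP [? ?]; rewrite ltr0n; lia.
have lpot_w i : (i <= l)%N -> lpot blk w i = \sum_(j < i) c j + (chi i - chi 0%N).
  move=> il; rewrite lpot_blocks.
  rewrite -(telescope_sumr chi (leq0n i)) big_mkord -big_split /=.
  apply: eq_bigr => j _.
  rewrite (eq_bigr (fun=> u j / m j)) => [|a /eqP aj]; last by rewrite mxE aj.
  rewrite (eq_bigl (fun a => a \in [set a | blk a == j]%SET)) => [|a];
    last by rewrite inE.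
  rewrite sumr_const -[_ *+ _]mulr_natr divfK //.
  by rewrite gt_eqF // m_gt0 // (leq_trans (ltn_ord j)).
exists w; split.
- move=> a; rewrite mxE; set j := blk a.
  have /s_bnd /andP [s1 s2] := blk_lt a.
  have mn : m j <= n%:R by rewrite ler_nat -[leqRHS]card_ord max_card.
  have mj := m_gt0 _ (blk_lt a).
  have u_bnd : 2^-1 <= u j <= m j - 2^-1.
    have : 1 <= (s j)%:R :> R by rewrite ler1n.
    have : (s j)%:R + 1 <= m j by rewrite natr1 ler_nat.
    by rewrite /u /chi; case: (A _); case: (A _) => /=; lra.
  have n0 : 0 < n%:R :> R by rewrite ltr0n.
  have inv_le : (2 * n%:R)^-1 <= (2 * m j)^-1.
    by rewrite lef_pV2 ?posrE ?mulr_gt0 // ler_wpM2l.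
  have e1 : (2 * m j)^-1 = 2^-1 / m j by field; rewrite gt_eqF.
  have e2 : 1 - (2 * m j)^-1 = (m j - 2^-1) / m j by field; rewrite gt_eqF.
  apply/andP; split;
    [apply: le_trans inv_le _ | apply: le_trans (_ : 1 - (2 * m j)^-1 <= _)].
  + by case/andP: u_bnd => lo hi; rewrite e1 ler_wpM2r // invr_ge0 ltW.
  + by case/andP: u_bnd => lo hi; rewrite e2 ler_wpM2r // invr_ge0 ltW.
  + by rewrite lerB.
- have := lpot_w l (leqnn l); rewrite chil subrr addr0 lpotE.
  rewrite (eq_bigl predT) => [->|a]; last by rewrite blk_lt.
  by rewrite -natr_sum s_sum.
- move=> a i al il Aa; rewrite /P /pot !lpot_w 1?ltnW // /chi.
  rewrite (modn_small al) (modn_small il) Aa.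
  by rewrite /=; ring.
Qed.

(** Coordinate moves of at most 1/(4n) change each potential by at most 1/4, hence a difference by
    at most the gap 1/2, and they stay within the margin 1/(2n). *)
Lemma near_center (A : pred nat) (w x : 'rV[R]_n) :
  centered A w -> \sum_a x 0 a = k%:R ->
  (forall a, `|(x - w) 0 a| <= (4 * n%:R)^-1) ->
  (forall a b, (a < l)%N -> (b < l)%N -> A a -> A b -> P x a = P x b) ->
  cell A x.
Proof.
move=> [w_bnd w_sum w_pot] x_sum xw x_pot.
have n0 : 0 < n%:R :> R by rewrite ltr0n.
split; first split=> // a.
  have := xw a; have := w_bnd a; rewrite !mxE ler_norml.
  have -> : (4 * n%:R)^-1 = (2 * n%:R)^-1 / 2 :> R by field; rewrite gt_eqF.
  have : 0 < (2 * n%:R)^-1 :> R by rewrite invr_gt0 mulr_gt0.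
  by lra.
move=> a i al il Aa.
case Ai: (A i); first by rewrite (x_pot a i).
have bnd j : `|P x j - P w j| <= 4^-1.
  rewrite potB; have -> : 4^-1 = n%:R * (4 * n%:R)^-1 :> R.
    by field; rewrite gt_eqF.
  exact: lpot_bound.
have := w_pot a i al il Aa; rewrite Ai /=.
by have := bnd a; have := bnd i; rewrite !ler_norml; lra.
Qed.

Lemma centered_cell (A : pred nat) w : centered A w -> cell A w.
Proof.
move=> cw; have [_ w_sum w_pot] := cw.
apply: (near_center cw) => // [a|a b al bl Aa Ab].
  by rewrite subrr mxE normr0 invr_ge0 mulr_ge0.
by rewrite (w_pot a b) // Ab mul0r addr0.
Qed.

Lemma cell_eq (A : pred nat) x a b :
  cell A x -> (a < l)%N -> (b < l)%N -> A a -> A b -> P x a = P x b.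
Proof. by move=> [_ xA] al bl Aa Ab; apply: le_anti; rewrite !xA. Qed.

(** The hypothesis on [pi] turns zero total and equal potentials on [A] into zero fiber sums; by
    [near_center] the cell fills that space around its center. *)
Lemma has_dim_cell (A : pred nat) (T : finType) (pi : 'I_n -> T) :
  (forall t, exists i, pi i = t) ->
  (forall v : 'rV[R]_n, (forall t, \sum_(i | pi i == t) v 0 i = 0) <->
     \sum_i v 0 i = 0 /\
     forall a b, (a < l)%N -> (b < l)%N -> A a -> A b ->
       lpot blk v a = lpot blk v b) ->
  has_dim (cell A) (n - #|T|).
Proof.
move=> surj piE; have [w cw] := cell_center A.
have [_ w_sum _] := cw.
have sumB (x : 'rV[R]_n) : \sum_i (x - w) 0 i = \sum_i x 0 i - k%:R.
  by rewrite -w_sum -sumrB; apply: eq_bigr => i _; rewrite !mxE.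
apply: (has_dim_fibers (p := w) (e := (4 * n%:R)^-1) surj).
- by rewrite invr_gt0 mulr_gt0 // ltr0n.
- move=> x Ax; apply/piE; split=> [|a b al bl Aa Ab].
    by rewrite sumB Ax.1.2 subrr.
  by rewrite -!(potB _ c) -!/(P _ _) (cell_eq Ax al bl)
    // (cell_eq (centered_cell cw) al bl).
- move=> x /piE [sum0 pot_eq] xw; apply: (near_center cw) => //.
    by apply/subr0_eq; rewrite -sumB.
  move=> a b al bl Aa Ab; have := pot_eq a b al bl Aa Ab.
  rewrite -!(potB _ c) -!/(P _ _) (cell_eq (centered_cell cw) al bl) //.
  exact: addIr.
Qed.

Lemma cell0 : cell pred0 = hypersimplex R n k.
Proof. by apply/seteqP; split=> [x []|x Dx] //; split. Qed.

Lemma has_dim_cell_le1 (A : pred nat) :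
  (forall a b, (a < l)%N -> (b < l)%N -> A a -> A b -> a = b) ->
  has_dim (cell A) (n - 1).
Proof.
move=> A1; rewrite -card_unit; apply: (@has_dim_cell _ _ (fun=> tt)).
  by move=> []; exists (Ordinal n_gt0).
move=> v; split=> [v0|[v0 _] []].
  split=> [|a b al bl Aa Ab]; last by rewrite (A1 a b).
  exact: (v0 tt).
exact: v0.
Qed.

(** A tie between a and b fixes the sum over blocks a, ..., b - 1. As the total is fixed too, the
    fibers are the two arcs of the block cycle. *)
Lemma has_dim_cell2 a b : (a < b)%N -> (b < l)%N ->
  has_dim (cell (pred2 a b)) (n - 2).
Proof.
move=> ab bl; rewrite -card_bool.
have al := ltn_trans ab bl.
pose pi i := (a <= blk i < b)%N.
have lpotBE (v : 'rV[R]_n) :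
    lpot blk v b - lpot blk v a = \sum_(i | pi i == true) v 0 i.
  rewrite !lpotE (bigID (fun i => (blk i < a)%N)) /=.
  rewrite (eq_bigl (fun i => (blk i < a)%N)) => [|i]; last by lia.
  rewrite addrC addrK; apply: eq_bigl => i; rewrite /pi; lia.
have sumE (v : 'rV[R]_n) : \sum_i v 0 i =
    \sum_(i | pi i == true) v 0 i + \sum_(i | pi i == false) v 0 i.
  by rewrite (bigID pi) /=; congr (_ + _); apply: eq_bigl => i; case: (pi i).
apply: (@has_dim_cell _ _ pi).
  case; first by have [i ia] := blk_surj al; exists i; rewrite /pi ia leqnn.
  by have [i ib] := blk_surj bl; exists i; rewrite /pi ib ltnn andbF.
move=> v; split=> [v0|[v0 pot_eq]].
  have eqab : lpot blk v b = lpot blk v a.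
    by apply/subr0_eq; rewrite lpotBE v0.
  split; first by rewrite sumE !v0 addr0.
  by move=> x y _ _ /= /orP[]/eqP-> /orP[]/eqP->.
have v_t : \sum_(i | pi i == true) v 0 i = 0.
  by rewrite -lpotBE (pot_eq b a) ?subrr //= eqxx ?orbT.
by case=> //; move: v0; rewrite sumE v_t add0r.
Qed.

(** All potentials tie exactly when every block sum is fixed, so the fibers are the blocks. *)
Lemma has_dim_cellT : has_dim (cell predT) (n - l).
Proof.
rewrite -[l in (n - l)%N]card_ord.
apply: (@has_dim_cell _ _ (fun a => Ordinal (blk_lt a))).
  by move=> j; have [i ij] := blk_surj (ltn_ord j); exists i; apply/val_inj.
have sumE (v : 'rV[R]_n) : \sum_i v 0 i = lpot blk v l.
  by rewrite lpotE; apply: eq_bigl => i; rewrite blk_lt.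
move=> v; split=> [v0|[v0 pot_eq] j].
  have lpot0 i : (i <= l)%N -> lpot blk v i = 0.
    move=> il; rewrite lpot_blocks big1 // => j _.
    exact: (v0 (widen_ord il j)).
  by split=> [|a b al bl _ _]; rewrite ?sumE lpot0 ?(lpot0 b) // ltnW.
have lpot0 i : (i <= l)%N -> lpot blk v i = 0.
  rewrite leq_eqVlt => /orP[/eqP ->|il]; first by rewrite -sumE.
  by rewrite (pot_eq i 0%N) ?l_gt0 // lpot_blocks big_ord0.
have := lpot0 _ (ltn_ord j); rewrite lpot_blocks big_ord_recr /=.
by rewrite -lpot_blocks lpot0 ?add0r // ltnW.
Qed.

Let Delta := hypersimplex R n k.

Definition cells : set (set 'rV[R]_n) := [set cell (pred1 a) | a in `I_l].

Hypothesis polytope_cell :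
  forall a, (a < l)%N -> is_polytope (cell (pred1 a)).

Lemma cellI A B : cell A `&` cell B = cell (predU A B).
Proof.
apply/seteqP; split=> [x [[Dx Ax] [_ Bx]]|x [Dx ABx]].
  by split=> // a i al il /orP[]; [exact: Ax|exact: Bx].
by split; split=> // a i al il Xa; apply: ABx => //=; rewrite Xa ?orbT.
Qed.

Lemma has_dim_cellI a b : (a < l)%N -> (b < l)%N -> a != b ->
  has_dim (cell (pred1 a) `&` cell (pred1 b)) (n - 2).
Proof.
wlog ab : a b / (a < b)%N => [wl al bl ab|al bl _].
  have [|ba|e] := ltngtP a b; first by move=> ?; apply: wl.
    by rewrite setIC; apply: wl => //; rewrite eq_sym.
  by rewrite e eqxx in ab.
by rewrite cellI; apply: has_dim_cell2.
Qed.

Lemma has_dim_cell1 a : (a < l)%N -> has_dim (cell (pred1 a)) (n - 1).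
Proof.
by move=> al; apply: has_dim_cell_le1 => // x y _ _ /= /eqP -> /eqP ->.
Qed.

Lemma has_dim_hypersimplex : has_dim Delta (n - 1).
Proof. by rewrite /Delta -cell0; apply: has_dim_cell_le1. Qed.

Lemma face_cell a b : (a < l)%N -> (b < l)%N ->
  is_face (cell (pred1 a) `&` cell (pred1 b)) (cell (pred1 a)).
Proof.
move=> al bl; exists (bdiff R blk a b), (\sum_(j < a) c j - \sum_(j < b) c j).
have PE x : P x a - P x b =
    lform (bdiff R blk a b) x - (\sum_(j < a) c j - \sum_(j < b) c j).
  by rewrite lform_bdiff /P /pot; ring.
split=> [x [_ /(_ a b al bl (eqxx a))]|].
  by rewrite -subr_le0 -/(P x a) -/(P x b) PE subr_le0.
apply/seteqP; split=> x.
  move=> [Ax Bx]; split=> //; apply/subr0_eq; rewrite -/(lform _ x) -PE.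
  apply/eqP; rewrite subr_eq0 eq_le; apply/andP; split.
    by apply: Ax.2 => /=.
  by apply: Bx.2 => /=.
move=> [Ax /eqP]; rewrite -subr_eq0 -/(lform _ x) -PE subr_eq0 => /eqP Pab.
split=> //; split; first by case: Ax.
by move=> i j il jl /eqP ->; rewrite -/(P x b) -Pab; apply: Ax.2 => /=.
Qed.

Lemma cells_cover : \bigcup_(Q in cells) Q = Delta.
Proof.
apply/seteqP; split=> [x [_ [a _ <-]] []//|x Dx].
have [m _ m_min] := arg_minP (P := predT) (fun i : 'I_l => P x i)
  (i0 := Ordinal (l_gt0)) isT.
exists (cell (pred1 (val m))); first by exists (val m) => /=.
by split=> // a i al il /eqP ->; apply: (m_min (Ordinal il)).
Qed.

Lemma cells_subdivision : is_subdivision Delta cells.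
Proof.
split.
- exact: finite_image.
- exists (n - 1)%N; split; first exact: has_dim_hypersimplex.
  by move=> _ [a al <-]; split; [exact: polytope_cell | exact: has_dim_cell1].
- exact: cells_cover.
- move=> _ _ [a al <-] [b bl <-]; split; first exact: face_cell.
  by rewrite setIC; apply: face_cell.
Qed.

(** The center of cell a has its strict minimum at a, so it lies in no other cell. *)
Lemma cell_inj a b : (a < l)%N -> (b < l)%N ->
  cell (pred1 a) = cell (pred1 b) -> a = b.
Proof.
move=> al bl ab; apply/eqP; apply/negP => /negP neq_ab.
have [w cw] := cell_center (pred1 a).
have : cell (pred1 a) w by apply: (centered_cell cw).
rewrite ab => -[_ /(_ b a bl al (eqxx b))].
have [_ _ /(_ a b al bl (eqxx a)) ->] := cw.
by rewrite /= eq_sym neq_ab /=; lra.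
Qed.

Lemma cells_card : (cells #= `I_l)%card.
Proof.
apply: inj_card_eq => a b; rewrite !inE /=; exact: cell_inj.
Qed.

(* Near a relative interior point w of the wall between cells a and b, the
   wall fills its hyperplane; so a linear form constant on the wall and at a
   point off that hyperplane is constant on {sum x = k}. *)
Lemma wall_separates (S : set (set 'rV[R]_n)) Q Q' a b x :
  is_subdivision Delta S -> S Q -> S Q' -> Q <> Q' ->
  (a < l)%N -> (b < l)%N -> cell (pred1 a) `<=` Q -> cell (pred1 b) `<=` Q' ->
  Q x -> Q' x -> P x a = P x b.
Proof.
move=> subS SQ SQ' QQ' al bl aQ bQ' Qx Q'x.
apply/eqP; apply/negP => /negP neqP; apply: QQ'.
apply: (subdivision_maximal subS) => // y Qy.
have [_ _ unS facS] := subS.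
have inD z : Q z -> Delta z by rewrite -unS => Qz; exists Q.
have [[f [d [_ eqF]]] _] := facS _ _ SQ SQ'.
have fQ z : Q z -> Q' z -> lform f z = d.
  move=> Qz Q'z; have : (Q `&` Q') z by [].
  by rewrite eqF => -[].
suff fy : lform f y = d by have [] : (Q `&` Q') y by rewrite eqF.
have [w cw] := cell_center (pred2 a b).
have cab z : cell (pred2 a b) z -> lform f z = d.
  have -> : cell (pred2 a b) = cell (predU (pred1 a) (pred1 b)) by [].
  by rewrite -cellI => -[/aQ Qz /bQ' Q'z]; apply: fQ.
have fw : lform f w = d by apply: cab; apply: (centered_cell cw).
have Pw : P w a = P w b.
  by apply: (cell_eq (centered_cell cw)); rewrite //= eqxx ?orbT.
have dx0 : P x a - P x b != 0 by rewrite subr_eq0.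
(* This [mu] makes [u] preserve the tie between a and b, so [w + t *: u] stays on the wall for small
   t. The form then vanishes on [u], and since it agrees at x and w it takes the value d at y. *)
pose mu := (P y a - P y b) / (P x a - P x b).
pose u := (y - w) - mu *: (x - w).
have u_sum : \sum_i u 0 i = 0.
  have [_ w_sum _] := cw; have [_ x_sum] := inD _ Qx; have [_ y_sum] := inD _ Qy.
  rewrite sum_lform /u !lformB lformZ lformB -!sum_lform w_sum x_sum y_sum; ring.
have u_pot : lpot blk u a = lpot blk u b.
  have uE i : lpot blk u i = (P y i - P w i) - mu * (P x i - P w i).
    by rewrite !(potB blk c) /lpot /u lformB lformZ.
  have mu_eq : mu * (P x a - P x b) = P y a - P y b by rewrite /mu divfK.
  by apply/subr0_eq; rewrite !uE Pw -(subrr (P y a - P y b)) -{2}mu_eq; ring.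
pose N := 1 + \sum_i `|u 0 i|.
have N_gt0 : 0 < N by rewrite ltr_pwDl // sumr_ge0.
have uN i : `|u 0 i| <= N.
  by rewrite /N (bigD1 i) //= addrCA lerDl addr_ge0 // sumr_ge0.
have n0 : 0 < n%:R :> R by rewrite ltr0n.
pose t := (4 * n%:R)^-1 / N.
have t_gt0 : 0 < t by rewrite divr_gt0 // invr_gt0 mulr_gt0.
have : lform f (w + t *: u) = d.
  apply: cab; apply: (near_center cw).
  - have [_ w_sum _] := cw.
    by rewrite sum_lform lformD lformZ -!sum_lform u_sum w_sum mulr0 addr0.
  - move=> i; rewrite addrC addKr mxE normrM (ger0_norm (ltW t_gt0)).
    by rewrite /t mulrAC ler_pdivrMr // ler_wpM2l // invr_ge0 mulr_ge0.
  - move=> i j il jl ai aj.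
    have eq_a h : pred2 a b h -> P (w + t *: u) h = P (w + t *: u) a.
      move=> /= /orP[]/eqP-> //.
      by rewrite /P !pot_scale u_pot -!/(P _ _) Pw.
    by rewrite (eq_a i) // (eq_a j).
rewrite lformD lformZ fw -[RHS]addr0 => /addrI /eqP.
rewrite mulf_eq0 gt_eqF //= => /eqP.
rewrite /u lformB lformZ !lformB fw (fQ _ Qx Q'x) subrr mulr0 subr0.
exact: subr0_eq.
Qed.

(** Either some cell of the coarsening contains two of the cells, and then it absorbs all of them,
    or each contains just one and equals it. *)
Lemma cells_coarsest : is_coarsest Delta cells.
Proof.
split=> [|S subS refS]; first exact: cells_subdivision.
have [_ _ unS _] := subS.
have ref a : (a < l)%N -> exists2 Q, S Q & cell (pred1 a) `<=` Q.
  by move=> al; apply: refS; exists a.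
have [[a [b [Q [al bl ab [SQ aQ bQ]]]]]|no_merge] := pselect (exists a b Q,
    [/\ (a < l)%N, (b < l)%N, a != b
      & [/\ S Q, cell (pred1 a) `<=` Q & cell (pred1 b) `<=` Q]]).
- left.
  have allQ i : (i < l)%N -> cell (pred1 i) `<=` Q.
    move=> il; have [->//|ia] := eqVneq i a; have [->//|ib] := eqVneq i b.
    have [Q' SQ' iQ'] := ref i il.
    have [->//|/eqP QQ'] := pselect (Q = Q').
    (* If cell i lay in another [Q'], the wall between b and i would lie in both [Q] and [Q'], so a
       and i would tie on it; but at its center a exceeds i by 1/2. *)
    have [w cw] := cell_center (pred2 b i).
    have : (cell (pred1 b) `&` cell (pred1 i)) w.
      by rewrite cellI; apply: (centered_cell cw).
    move=> [/bQ Qw /iQ' Q'w].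
    have := wall_separates subS SQ SQ' (elimN eqP QQ') al il aQ iQ' Qw Q'w.
    have [_ _ /(_ i a il al)] := cw; rewrite /P /= eqxx orbT => /(_ isT) ->.
    by rewrite negb_or ab eq_sym ia /=; lra.
  have DQ : Delta `<=` Q.
    by rewrite -cells_cover => x [_ [i il <-]]; apply: allQ.
  have S1 : S = [set Q].
    apply: (subdivision_cover subS) => [_ ->//|x Dx].
    by exists Q => //; apply: DQ.
  rewrite /trivial_subdivision S1; congr [set _].
  by apply/seteqP; split=> // x Qx; rewrite -unS; exists Q.
- right; apply: (subdivision_cover subS); last by rewrite cells_cover.
  move=> _ [a al <-]; have [Q SQ aQ] := ref a al.
  suff -> : cell (pred1 a) = Q by [].
  apply/seteqP; split=> // x Qx.
  have Dx : Delta x by rewrite -unS; exists Q.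
  move: (Dx); rewrite -cells_cover => -[_ [b bl <-] bx].
  have [->//|ab] := eqVneq a b.
  have [Q' SQ' bQ'] := ref b bl.
  have QQ' : Q <> Q'.
    by move=> e; apply: no_merge; exists a, b, Q; split=> //; split=> //; rewrite e.
  (* As [x] lies in both [Q] and [Q'], the index a ties with the minimizer b, so [x] is already in
     cell a. *)
  have Pab := wall_separates subS SQ SQ' QQ' al bl aQ bQ' Qx (bQ' _ bx).
  split=> // i j il jl /eqP ->; rewrite -/(P x a) Pab.
  by apply: bx.2 => /=.
Qed.

Lemma cells_inter : \bigcap_(Q in cells) Q = cell predT.
Proof.
apply/seteqP; split=> [x Qx|x [Dx Tx] _ [a al <-]].
  have cx a : (a < l)%N -> cell (pred1 a) x by move=> al; apply: Qx; exists a.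
  split=> [|a i al il _]; first by case: (cx _ (l_gt0)).
  by apply: (cx a al).2 => /=.
by split=> // i j il jl _; apply: Tx.
Qed.

Lemma cells_split : (1 < n)%N -> is_split l Delta cells.
Proof.
move=> n_gt1; split.
- exact: l_gt0.
- exact: cells_coarsest.
- exact: cells_card.
- move=> _ _ [a al <-] [b bl <-] ab.
  have {}ab : a != b by apply: contra_not_neq ab => ->.
  have n21 : (n - 2).+1 = (n - 1)%N by lia.
  split; split; try by apply: face_cell.
  + exists (n - 2)%N; rewrite n21; split; first exact: has_dim_cell1.
    exact: has_dim_cellI.
  + by rewrite setIC; apply: face_cell.
  + exists (n - 2)%N; rewrite n21; split; first exact: has_dim_cell1.
    exact: has_dim_cellI.
- exists (n - 1)%N, (n - l)%N; split.
  + exact: has_dim_hypersimplex.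
  + by rewrite cells_inter; apply: has_dim_cellT.
  (* Subtraction is truncated, so (n - l) + (l - 1) = n - 1 requires l <= n; one element chosen per
     block gives it. *)
  + have : (l <= n)%N.
      have surj (j : 'I_l) : exists a, Ordinal (blk_lt a) == j.
        by have [a aj] := blk_surj (ltn_ord j); exists a; apply/eqP/val_inj.
      pose f j := xchoose (surj j).
      have f_inj : injective f.
        move=> i j fij; have /eqP <- := xchooseP (surj i).
        by have /eqP <- := xchooseP (surj j); rewrite -/(f i) -/(f j) fij.
      by have := leq_card f f_inj; rewrite !card_ord.
    by have := l_gt0; lia.
Qed.

End Cells.

(** * Polytopes of Schubert matroids *)

Section GaleOrder.
Context (R : realType) (n k : nat) (pos : 'I_n -> nat) (I : {set 'I_n}).
Hypothesis pos_inj : injective pos.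
Hypothesis card_I : #|I| = k.

Definition prefix_count (X : {set 'I_n}) (m : nat) : nat :=
  (\sum_(a | pos a < m) (a \in X))%N.

(* The bases at least I in the Gale order given by pos: a Schubert matroid. *)
Definition gale_bases : {set {set 'I_n}} :=
  [set X : {set 'I_n} | (#|X| == k) &&
     `[< forall m, (prefix_count I m <= prefix_count X m)%N >]]%SET.

Lemma gale_basesP (X : {set 'I_n}) : reflect
  (#|X| = k /\ forall m, (prefix_count I m <= prefix_count X m)%N)
  (X \in gale_bases).
Proof.
rewrite inE; apply: (iffP andP) => [[/eqP ? /asboolP]|[-> ?]] //.
by split=> //; apply/asboolP.
Qed.

(* The first element of Y \ X can be exchanged for any x in X \ Y. *)
Lemma gale_bases_matroid : matroid_bases k gale_bases.
Proof.
split.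
- by apply/set0Pn; exists I; apply/gale_basesP.
- by move=> X /gale_basesP [].
- move=> X Y /gale_basesP [cardX IX] /gale_basesP [cardY IY] x.
  rewrite !inE => /andP [xY xX].
  have [y0 y0P] : exists y0, y0 \in (Y :\: X)%SET.
    apply/card_gt0P; rewrite cardsD cardY -cardX.
    have : (#|Y :&: X| < #|X|)%N.
      apply: proper_card; apply/properP; split; first exact: subsetIr.
      by exists x => //; rewrite inE (negPf xY).
    by lia.
  have [y yYX y_min] := arg_minnP pos y0P.
  have /setDP [yY yX] := yYX.
  have xy : x != y by apply: contraNneq yX => <-.
  exists y; first exact: yYX.
  apply/gale_basesP; split.
    by rewrite cardsU1 !inE (negPf yX) andbF /= -cardX (cardsD1 x X) xX.
  move=> m.
  have step : (prefix_count (y |: X :\ x) m + (pos x < m) =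
      prefix_count X m + (pos y < m))%N.
    have ind z : (pos z < m)%N = (\sum_(a | pos a < m) (a == z))%N :> nat.
      rewrite big_mkcond (bigD1 z) //= eqxx big1 => [|a /negPf ->].
        by case: ltnP.
      by case: ifP.
    rewrite /prefix_count !ind -!big_split /=; apply: eq_bigr => a _; rewrite !inE.
    have [->|ax] := eqVneq a x; first by rewrite xX (negPf xy).
    by have [->|ay] := eqVneq a y; rewrite ?(negPf yX) //= addn0.
  have IXm := IX m.
  move: step; have [xm|xm] := ltnP (pos x) m; last first.
    by rewrite addn0 => ->; apply: leq_trans IXm (leq_addr _ _).
  have [ym|ym] := ltnP (pos y) m; first by move=> /addIn ->.
  (* Here x precedes m and y does not, so the prefix of [X] loses one element. All elements of [Y]
     before m lie in [X] by the choice of y, and x is in [X] but not in [Y]; so the count of [X]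
     strictly exceeds that of [Y], hence that of [I]. *)
  rewrite addn0 addn1 => eqX; rewrite -ltnS eqX.
  apply: leq_ltn_trans (IY m) _.
  rewrite /prefix_count (bigD1 x) //= [ltnRHS](bigD1 x) //= (negPf xY) xX.
  rewrite add0n add1n ltnS; apply: leq_sum => a /andP [am _].
  case aY: (a \in Y) => //; case aX: (a \in X) => //.
  have /y_min : a \in (Y :\: X)%SET by rewrite inE aX aY.
  by rewrite leqNgt (leq_trans am ym).
Qed.

(** The inequality description of the base polytope of the Schubert matroid. *)
Definition gale_polytope : set 'rV[R]_n :=
  [set y | hypersimplex R n k y /\
     forall m, lpot pos (evec R I) m <= lpot pos y m].

Definition fractional (y : 'rV[R]_n) : {set 'I_n} :=
  [set a | 0 < y 0 a < 1]%SET.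

Lemma lpot_evec X m : lpot pos (evec R X) m = (prefix_count X m)%:R.
Proof. by rewrite lpotE natr_sum; apply: eq_bigr => a _; rewrite mxE. Qed.

Lemma nonfractional_int (y : 'rV[R]_n) a :
  hypersimplex R n k y -> a \notin fractional y -> y 0 a \is a Num.int.
Proof.
move=> [/(_ a) /andP [y0 y1] _]; rewrite inE negb_and -!leNgt.
move=> /orP [ya|ya].
  by have -> : y 0 a = 0 by apply: le_anti; rewrite y0 ya.
by have -> : y 0 a = 1 by apply: le_anti; rewrite y1 ya.
Qed.

Lemma int_between (x : R) : x \is a Num.int -> ~ (0 < x < 1).
Proof.
move=> /intrP [z ->]; rewrite ltr0z ltrz1; lia.
Qed.

Lemma int_gtN1 (x : R) : x \is a Num.int -> - 1 < x -> 0 <= x.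
Proof.
move=> /intrP [z ->]; rewrite -[- 1]/((-1)%:~R) ltr_int ler0z; lia.
Qed.

(* Between the first two fractional coordinates p < q the prefix sums are
   nonintegral, hence slack, so y can move both ways along e_p - e_q until one
   more coordinate becomes integral. *)
Lemma gale_polytope_integral (y : 'rV[R]_n) : gale_polytope y ->
  conv_hull [set evec R X | X in [set` gale_bases]] y.
Proof.
have [N] := ubnP #|fractional y|; elim: N y => // N IHN y; rewrite ltnS => yN Qy.
have [Dy lpot_y] := Qy; have [y01 y_sum] := Dy.
have y_int a : a \notin fractional y -> y 0 a \is a Num.int.
  exact: nonfractional_int.
have [frac0|[p0 p0P]] := set_0Vmem (fractional y).
  apply: sub_conv_hull; pose X := [set a | y 0 a == 1]%SET.
  have yX : evec R X = y.
    apply/rowP => a; rewrite mxE inE; have := y01 a.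
    have : a \notin fractional y by rewrite frac0 inE.
    rewrite inE; have [->//|y1] := eqVneq (y 0 a) 1.
    rewrite negb_and -!leNgt => /orP[ya|ya] /andP [y0 y1'].
      by apply: le_anti; rewrite y0 ya.
    by case/eqP: y1; apply: le_anti; rewrite y1' ya.
  exists X => //=; apply/gale_basesP; split.
    apply/eqP; rewrite -(eqr_nat R) -y_sum -yX -sum1_card natr_sum big_mkcond.
    by apply/eqP; apply: eq_bigr => a _; rewrite mxE; case: (a \in X).
  by move=> m; rewrite -(ler_nat R) -!lpot_evec yX.
have [p pF p_min] := arg_minnP pos p0P.
(* A single fractional coordinate is impossible, because the coordinate sum is an integer. *)
have [q0 q0P] : exists q0, q0 \in (fractional y :\ p)%SET.
  apply/set0Pn; apply/negP => /eqP only_p.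
  have : y 0 p \is a Num.int.
    have -> : y 0 p = k%:R - \sum_(a | a != p) y 0 a.
      by rewrite -y_sum (bigD1 p) //= addrK.
    rewrite rpredB ?rpred_nat // rpred_sum // => a ap; apply: y_int.
    apply/negP => aF; have : a \in (fractional y :\ p)%SET by rewrite in_setD1 ap aF.
    by rewrite only_p inE.
  move=> /int_between; apply; have : p \in fractional y := pF.
  by rewrite inE.
have [q qF q_min] := arg_minnP pos q0P.
have {}pF : p \in fractional y := pF.
have {}qF : q \in (fractional y :\ p)%SET := qF.
move: (qF) (pF); rewrite !inE => /and3P [qp q_gt0 q_lt1] /andP [p_gt0 p_lt1].
have pos_pq : (pos p < pos q)%N.
  have /p_min le_pq : q \in fractional y by rewrite inE q_gt0.
  rewrite ltn_neqAle le_pq andbT.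
  by apply: contraNneq qp => /pos_inj ->.
pose v : 'rV[R]_n := delta_mx 0 p - delta_mx 0 q.
have v_p : v 0 p = 1 by rewrite !mxE !eqxx eq_sym (negPf qp) subr0.
have v_q : v 0 q = -1 by rewrite !mxE !eqxx (negPf qp) sub0r.
have v_a a : a != p -> a != q -> v 0 a = 0.
  by move=> ap aq; rewrite !mxE (negPf ap) (negPf aq) !andbF subrr.
have lform_v h : lform h v = h p - h q.
  rewrite /lform (bigD1 p) //= (bigD1 q) //= v_p v_q big1.
    by rewrite mulr1 mulrN1 addr0.
  by move=> a /andP [ap aq]; rewrite v_a ?mulr0.
clearbody v.
(* Only [y 0 p] is fractional in a prefix ending between p and q, so the slack minus [y 0 p] is an
   integer above -1. Lowering coordinate p down to 0 thus violates no prefix inequality. *)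
have slack m : (pos p < m <= pos q)%N ->
    y 0 p <= lpot pos y m - lpot pos (evec R I) m.
  move=> /andP [pm mq].
  rewrite -subr_ge0; apply: int_gtN1.
    rewrite lpot_evec [lpot pos y m]lpotE (bigD1 p) //=.
    set T := \sum_(i | _) _; set C := _%:R.
    have -> : y 0 p + T - C - y 0 p = T - C by ring.
    rewrite rpredB ?rpred_nat // rpred_sum // => a /andP [am ap]; apply: y_int.
    apply/negP => aF; have /q_min : a \in (fractional y :\ p)%SET.
      by rewrite in_setD1 ap.
    by rewrite leqNgt (leq_trans am mq).
  by have := lpot_y m; lra.
have shift t : - y 0 p <= t <= 1 - y 0 p -> y 0 q - 1 <= t <= y 0 q ->
    (y 0 p + t == 0) || (y 0 p + t == 1) || (y 0 q - t == 0) || (y 0 q - t == 1) ->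
    conv_hull [set evec R X | X in [set` gale_bases]] (y + t *: v).
  move=> tp tq t_end.
  have yt_p : (y + t *: v) 0 p = y 0 p + t by rewrite mxE [X in _ + X]mxE v_p mulr1.
  have yt_q : (y + t *: v) 0 q = y 0 q - t by rewrite mxE [X in _ + X]mxE v_q mulrN1.
  have yt_a a : a != p -> a != q -> (y + t *: v) 0 a = y 0 a.
    by move=> ap aq; rewrite mxE [X in _ + X]mxE v_a // mulr0 addr0.
  apply: IHN.
    apply: leq_trans yN; apply: proper_card; apply/properP; split.
      apply/fintype.subsetP => a; have [-> //|ap] := eqVneq a p.
      have [-> _|aq] := eqVneq a q; first by rewrite inE q_gt0 q_lt1.
      by rewrite !inE yt_a.
    have {}qF : q \in fractional y by rewrite inE q_gt0.
    by move: t_end => /orP[/orP[/orP[]|]|] /eqP e;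
      [exists p|exists p|exists q|exists q] => //;
      rewrite inE ?yt_p ?yt_q e ltxx ?andbF.
  split; first split.
  - move=> a; have [->|ap] := eqVneq a p; first by rewrite yt_p; lra.
    have [->|aq] := eqVneq a q; first by rewrite yt_q; lra.
    by rewrite yt_a.
  - by rewrite sum_lform lformD lformZ lform_v subrr mulr0 addr0 -sum_lform.
  - move=> m; rewrite /lpot lformD lformZ lform_v -!/(lpot _ _ _).
    have := lpot_y m.
    have [pm|pm] := ltnP (pos p) m; have [qm|qm] := ltnP (pos q) m => /=.
    + by rewrite subrr mulr0 addr0.
    + by have := slack m; rewrite pm qm => /(_ isT); lra.
    + by have := ltn_trans pos_pq qm; rewrite ltnNge pm.
    + by rewrite subrr mulr0 addr0.
(* [u] and [d] are the largest steps along [v] and [- v] that keep coordinates p and q in [0, 1];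
   [y] is the mean of the two end points with weights d / (u + d) and u / (u + d). *)
have [u [u0 up uq ue]] : exists u : R, [/\ 0 < u, u <= 1 - y 0 p, u <= y 0 q
    & (u == 1 - y 0 p) || (u == y 0 q)].
  have [le|lt] := leP (1 - y 0 p) (y 0 q).
    by exists (1 - y 0 p); rewrite eqxx; split=> //; lra.
  by exists (y 0 q); rewrite eqxx orbT; split=> //; lra.
have [d [d0 dp dq de]] : exists d : R, [/\ 0 < d, d <= y 0 p, d <= 1 - y 0 q
    & (d == y 0 p) || (d == 1 - y 0 q)].
  have [le|lt] := leP (y 0 p) (1 - y 0 q).
    by exists (y 0 p); rewrite eqxx; split=> //; lra.
  by exists (1 - y 0 q); rewrite eqxx orbT; split=> //; lra.
have hu : conv_hull [set evec R X | X in [set` gale_bases]] (y + u *: v).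
  apply: shift; [lra|lra|].
  have {}ue : (y 0 p + u == 1) || (y 0 q - u == 0).
    by case/orP: ue => /eqP ->; apply/orP; [left|right]; apply/eqP; lra.
  by case/orP: ue => ->; rewrite ?orbT.
have hd : conv_hull [set evec R X | X in [set` gale_bases]] (y + (- d) *: v).
  apply: shift; [lra|lra|].
  have {}de : (y 0 p - d == 0) || (y 0 q + d == 1).
    by case/orP: de => /eqP ->; apply/orP; [left|right]; apply/eqP; lra.
  by case/orP: de => e; rewrite ?opprK e ?orbT.
have ud : u + d != 0 by rewrite gt_eqF // addr_gt0.
have := conv_hull_convex (t := d / (u + d)) hu hd.
have -> : d / (u + d) *: (y + u *: v) + (1 - d / (u + d)) *: (y + (- d) *: v) = y.
  rewrite !scalerDr !scalerA addrACA -!scalerDl.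
  have -> : d / (u + d) + (1 - d / (u + d)) = 1 by ring.
  have -> : d / (u + d) * u + (1 - d / (u + d)) * - d = 0 by field.
  by rewrite scale1r scale0r addr0.
apply; apply/andP; split; first by rewrite divr_ge0 // ltW // addr_gt0.
by rewrite ler_pdivrMr ?addr_gt0 // mul1r lerDr ltW.
Qed.

Lemma gale_polytope_matroid : is_matroid_polytope k gale_polytope.
Proof.
exists gale_bases; split; first exact: gale_bases_matroid.
apply/seteqP; split=> [y|]; first exact: gale_polytope_integral.
move=> _ [N [w [a [w_ge0 w_sum aB ->]]]].
have aQ j : gale_polytope (a j).
  have [X XB <-] := aB j; have /gale_basesP [cardX IX] := XB.
  split; first split=> [i|].
  - by rewrite mxE; case: (_ \in _); rewrite ?lexx ler01.
  - rewrite -cardX -sum1_card natr_sum [RHS]big_mkcond.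
    by apply: eq_bigr => i _; rewrite mxE; case: (_ \in _).
  - by move=> m; rewrite !lpot_evec ler_nat.
have lform_comb h : lform h (\sum_i w i *: a i) = \sum_i w i * lform h (a i).
  by rewrite lform_sum; apply: eq_bigr => i _; rewrite lformZ.
split; first split=> [i|].
- rewrite summxE; apply/andP; split.
    apply: sumr_ge0 => j _; rewrite mxE mulr_ge0 //.
    by have [[/(_ i) /andP []]] := aQ j.
  rewrite -w_sum; apply: ler_sum => j _; rewrite mxE ler_piMr //.
  by have [[/(_ i) /andP []]] := aQ j.
- rewrite sum_lform lform_comb.
  rewrite (eq_bigr (fun j => w j * k%:R)) => [|j _].
    by rewrite -mulr_suml w_sum mul1r.
  by rewrite -sum_lform; have [[_ ->]] := aQ j.
- move=> m; rewrite [leRHS]lform_comb.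
  have -> : lpot pos (evec R I) m = \sum_j w j * lpot pos (evec R I) m.
    by rewrite -mulr_suml w_sum mul1r.
  by apply: ler_sum => j _; rewrite ler_wpM2l //; have [_] := aQ j; apply.
Qed.

End GaleOrder.

Lemma matroid_polytope_polytope (R : realType) (n k : nat) (P : set 'rV[R]_n) :
  is_matroid_polytope k P -> is_polytope P.
Proof.
move=> [B [_ ->]]; exists [set evec R X | X in [set` B]]; split=> //.
exact/finite_image/finite_finset.
Qed.

(** * Cones of decorated ordered set partitions *)

Section ListCones.
Context (R : realType) (n : nat).
Implicit Types (D E : seq (seq 'I_n * int)) (x : 'rV[R]_n).

(** Keeping blocks as lists turns unions of consecutive blocks into concatenations, that is, into
    prefixes of the cycle. *)
Definition deco D : decorated n := [seq ([set a in p.1]%SET, p.2) | p <- D].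

Definition block_of D (a : 'I_n) : nat := find (fun p => a \in p.1) D.

Definition weight D (j : nat) : R := (nth 0 [seq p.2 | p <- D] j)%:~R.

Definition excess x (p : seq 'I_n * int) : R :=
  \sum_(a <- p.1) x 0 a - p.2%:~R.

Lemma bigcup_deco E :
  (\bigcup_(p <- deco E) p.1)%SET = [set a in flatten [seq p.1 | p <- E]]%SET.
Proof.
elim: E => [|p E IHE] /=; first by rewrite big_nil; apply/setP => a; rewrite !inE.
by rewrite big_cons IHE; apply/setP => a; rewrite !inE mem_cat.
Qed.

Lemma xsum_deco x E : uniq (flatten [seq p.1 | p <- E]) ->
  xsum x (\bigcup_(p <- deco E) p.1)%SET - (\sum_(p <- deco E) p.2)%:~R
  = \sum_(p <- E) excess x p.
Proof.
move=> uE; rewrite /excess sumrB bigcup_deco /xsum.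
rewrite (eq_bigl (fun a => a \in flatten [seq p.1 | p <- E])) => [|a];
  last by rewrite inE.
rewrite -big_uniq // big_flatten /= big_map; congr (_ - _).
by rewrite big_map /= rmorph_sum.
Qed.

Lemma block_ofP D a j p0 : uniq (flatten [seq p.1 | p <- D]) ->
  (j < size D)%N -> (block_of D a == j) = (a \in (nth p0 D j).1).
Proof.
elim: D j => [|p D IHD] //= [|j]; rewrite /block_of /= cat_uniq => /and3P [_ pD uD].
  by case: ifP.
rewrite ltnS => jD; rewrite -(IHD _ uD jD) /block_of.
case: ifP => ap; last by rewrite eqSS.
symmetry; apply/negP; rewrite -/(block_of D a) (IHD _ uD jD) => aj.
case/negP: pD; apply/hasP; exists a => //=.
apply/flattenP; exists (nth p0 D j).1 => //.
by apply: map_f; apply: mem_nth.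
Qed.

Lemma pot_excess D x i : uniq (flatten [seq p.1 | p <- D]) -> (i <= size D)%N ->
  pot (block_of D) (weight D) x i = \sum_(p <- take i D) excess x p.
Proof.
move=> uD iD; rewrite /pot lpot_blocks -sumrB.
rewrite (big_nth ([::], 0)) big_mkord size_take_min (minn_idPl iD).
apply: eq_bigr => j _; have jD := leq_trans (ltn_ord j) iD.
rewrite nth_take // /excess /weight (nth_map ([::], 0)) //; congr (_ - _).
rewrite (eq_bigl (fun a => a \in (nth ([::], 0) D j).1)) => [|a]; last first.
  exact: block_ofP.
rewrite -big_uniq //.
have : subseq (nth ([::], 0) D j).1 (flatten [seq p.1 | p <- D]).
  elim: (D) (nat_of_ord j) jD => [|p D' IH] //= [|m] mD; first exact: prefix_subseq.
  by apply: subseq_trans (IH m mD) _; apply: suffix_subseq.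
by move/subseq_uniq; apply.
Qed.

Lemma sum_excess D x :
  uniq (flatten [seq p.1 | p <- D]) -> (forall a, a \in flatten [seq p.1 | p <- D]) ->
  \sum_(p <- D) excess x p = \sum_a x 0 a - (\sum_(p <- D) p.2)%:~R.
Proof.
move=> uD allD; rewrite sumrB rmorph_sum /=; congr (_ - _).
rewrite -(big_map (fun p => p.1) predT (fun L => \sum_(a <- L) x 0 a)) -big_flatten.
by rewrite big_uniq //=; apply: eq_bigl => a; rewrite allD.
Qed.

(** The inequalities of the rotated cone say that partial sums of [excess] starting at j are
    nonnegative. The total excess is 0 on the hyperplane, so these are differences of potentials
    even past the end of the list. *)
Lemma cone_deco k D j :
  uniq (flatten [seq p.1 | p <- D]) -> (forall a, a \in flatten [seq p.1 | p <- D]) ->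
  \sum_(p <- D) p.2 = k -> (j < size D)%N ->
  cone R k (rot j (deco D)) = pot_cone (block_of D) k (size D) (weight D) j.
Proof.
move=> uD allD sumD jD; set l := size D.
pose G x i := \sum_(p <- take i D) excess x p.
have potG x i : (i <= l)%N -> pot (block_of D) (weight D) x i = G x i.
  exact: pot_excess.
have Gl x : hyperplane R n k x -> G x l = 0.
  by move=> Hx; rewrite /G take_size sum_excess // sumD Hx subrr.
have G0 x : G x 0%N = 0 by rewrite /G take0 big_nil.
have condE x m : (m < l)%N ->
    ((\sum_(p <- take m (rot j (deco D))) p.2)%:~R
         <= xsum x (\bigcup_(p <- take m (rot j (deco D))) p.1)%SET)
    = (0 <= \sum_(p <- take m (rot j D)) excess x p).
  move=> ml; rewrite /deco -map_rot -map_take -/(deco _) -subr_ge0 xsum_deco //.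
  have : uniq (flatten [seq p.1 | p <- rot j D]).
    rewrite map_rot -(perm_uniq (_ : perm_eq (flatten [seq p.1 | p <- D]) _)) //.
    by apply: perm_flatten; rewrite perm_sym perm_rot.
  rewrite -[in uniq _](cat_take_drop m (rot j D)) map_cat flatten_cat cat_uniq.
  by case/and3P.
have rotE x m : hyperplane R n k x -> (0 < m < l)%N ->
    \sum_(p <- take m (rot j D)) excess x p
    = G x (if (j + m <= l)%N then (j + m)%N else (j + m - l)%N) - G x j.
  move=> Hx /andP [m0 ml]; rewrite /rot take_cat size_drop -/l.
  have cutE : G x l = G x j + \sum_(p <- drop j D) excess x p.
    by rewrite /G take_size -big_cat cat_take_drop.
  case: ifP => mlj.
    have -> : (j + m <= l)%N by lia.
    by rewrite /G takeD big_cat /= addrAC subrr add0r.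
  rewrite big_cat /= take_takel; last by lia.
  move: cutE; rewrite (Gl _ Hx) => cutE.
  have -> : \sum_(p <- drop j D) excess x p = - G x j by lra.
  have jl : (j <= l)%N := ltnW jD.
  have lj_m : (l - j <= m)%N by rewrite leqNgt mlj.
  rewrite addrC; congr (_ + _).
  case: ifP => jml.
    have m_lj : m = (l - j)%N.
      by apply/eqP; rewrite eqn_leq lj_m leq_subRL // jml.
    by rewrite m_lj subnn take0 big_nil subnKC // (Gl _ Hx).
  by rewrite subnBA // addnC.
apply/seteqP; split=> x [Hx ineq]; split=> //.
- move=> i il; rewrite !potG 1?ltnW //.
  have [->//|ij] := eqVneq i j.
  have from_m m : (0 < m < l)%N ->
      G x j <= G x (if (j + m <= l)%N then (j + m)%N else (j + m - l)%N).
    move=> m_bnd; have ml : (m < l)%N by case/andP: m_bnd.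
    have := ineq m; rewrite size_rot size_map => /(_ m_bnd).
    by rewrite condE // rotE // subr_ge0.
  have [ji|{}ij] : (j < i \/ i < j)%N by case: ltngtP ij => //; [left|right].
    have := from_m (i - j)%N.
    by rewrite subn_gt0 ji (leq_ltn_trans (leq_subr j i) il) subnKC ltnW ?il //; apply.
  (* Reaching i < j from j takes l - (j - i) blocks, wrapping around the end. *)
  have := from_m (l - (j - i))%N; rewrite subn_gt0 (leq_ltn_trans (leq_subr i j) jD).
  rewrite ltn_subrL subn_gt0 ij (leq_ltn_trans (leq0n _) jD) => /(_ isT).
  have -> : (j + (l - (j - i)) = l + i)%N.
    by rewrite subnBA 1?ltnW // addnC subnK // (leq_trans (ltnW jD)) // leq_addr.
  case: i il ij {from_m} => [|i] _ _; first by rewrite addn0 leqnn (Gl _ Hx) G0.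
  by rewrite leqNgt -[X in (X < _)%N]addn0 ltn_add2l /= addKn.
- move=> m; rewrite size_rot size_map => m_bnd.
  have ml : (m < l)%N by case/andP: m_bnd.
  rewrite condE // rotE // subr_ge0.
  case: ifP => jml.
    have [e|lt] : (j + m = l \/ j + m < l)%N by lia.
      rewrite e (Gl _ Hx) -(G0 x) -!potG ?(ltnW jD) //.
      by apply: ineq; lia.
    by rewrite -!potG ?(ltnW jD) //; apply: ineq.
  by rewrite -!potG ?(ltnW jD) //; [apply: ineq|]; lia.
Qed.

End ListCones.

(** * Cyclic intervals *)

Section Runs.
Context (n : nat).
Implicit Types (s t u v : seq 'I_n) (J K I : {set 'I_n}).
Implicit Types (CI : seq (seq 'I_n * seq 'I_n)).

Lemma consecutiveP s J : size s = n ->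
  reflect (exists r t v, [/\ rot r s = t ++ v, t <> [::] & J = [set a in t]%SET])
    (consecutive s J).
Proof.
move=> sn; apply: (iffP idP) => [/existsP [r /existsP [m /eqP ->]]|].
  exists r, (take m.+1 (rot r s)), (drop m.+1 (rot r s)).
  split=> //; first by rewrite cat_take_drop.
  move/(congr1 size); rewrite size_take_min size_rot sn /=.
  by have := ltn_ord m; lia.
move=> [r [t [v [rE t0 ->]]]].
have tn : (size t <= n)%N.
  by have := size_rot r s; rewrite rE size_cat sn; lia.
have t_gt0 : (0 < size t)%N by case: (t) t0.
have [r' r'n rE'] : exists2 r', (r' < n)%N & rot r s = rot r' s.
  have [rn|nr] := ltnP r n; first by exists r.
  by exists 0%N; [exact: leq_trans tn|rewrite rot0 rot_oversize ?sn].
have mn : ((size t).-1 < n)%N by rewrite prednK.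
apply/existsP; exists (Ordinal r'n); apply/existsP; exists (Ordinal mn) => /=.
by rewrite -rE' rE prednK // take_size_cat.
Qed.

Lemma consecutive_rot q s J : size s = n ->
  consecutive (rot q s) J = consecutive s J.
Proof.
move=> sn; have sqn : size (rot q s) = n by rewrite size_rot.
apply/(consecutiveP _ sqn)/(consecutiveP _ sn) => -[r [t [v [rE t0 ->]]]].
  by rewrite rot_rot_add in rE; exists (rot_add s q r), t, v.
exists (rot_add (rot q s) (size (rot q s) - q) r), t, v.
by rewrite -rot_rot_add -/(rotr q _) rotK.
Qed.

Lemma cyclic_intervals_rot q s K : size s = n ->
  cyclic_intervals (rot q s) K = cyclic_intervals s K.
Proof.
move=> sn; apply: eq_finset => J; apply: maxset_eq => B /=.
by rewrite consecutive_rot.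
Qed.

Lemma mem_cyclic_intervals s K J : (J \in cyclic_intervals s K) =
  maxset (fun B => (B \subset K)%SET && consecutive s B) J.
Proof. by rewrite finset.in_set. Qed.

Definition runs K CI : bool :=
  all (fun p => [&& p.1 != [::], p.2 != [::],
                    all (fun a => a \notin K) p.1 & all (fun a => a \in K) p.2]) CI.

Definition unruns CI := flatten [seq p.1 ++ p.2 | p <- CI].

(** Cut off the longest prefix outside [K], then the longest prefix inside [K]; the rest, if
    nonempty, again starts outside and ends inside. *)
Lemma runs_exist K s : s <> [::] ->
  (forall d, head d s \notin K) -> (forall d, last d s \in K) ->
  exists2 CI, runs K CI & s = unruns CI.
Proof.
have [N] := ubnP (size s); elim: N s => // N IHN s; rewrite ltnS => sN s0 hs ls.
have [d sd] : exists d, d \in s by case: (s) s0 => // d *; exists d; rewrite mem_head.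
have ls' : last d s \in s by case: (s) s0 => //= x s' _; apply: mem_last.
have hasK : has (mem K) s by apply/hasP; exists (last d s) => //; exact: ls.
pose A := take (find (mem K) s) s; pose s1 := drop (find (mem K) s) s.
have As : s = A ++ s1 by rewrite cat_take_drop.
have AK : all (fun a => a \notin K) A.
  apply/allP => a aA; apply/negP => aK.
  have := before_find d (index_ltn aA).
  by rewrite /= nth_index ?aK // (mem_take aA).
have A0 : A != [::].
  rewrite -size_eq0 size_takel ?find_size // -lt0n.
  by case: (s) s0 (hs d) => //= x s' _ /negPf ->.
have s1K : head d s1 \in K by rewrite -nth0 nth_drop addn0; apply: nth_find.
have s1_0 : s1 <> [::].
  move=> e; move: As hasK AK; rewrite e cats0 => -> /hasP [a aA aK].
  by move=> /allP /(_ a aA); rewrite (aK : a \in K).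
pose m := find (fun a => a \notin K) s1.
pose B := take m s1; pose s2 := drop m s1.
have Bs : s1 = B ++ s2 by rewrite cat_take_drop.
have BK : all (fun a => a \in K) B.
  apply/allP => a aB; apply/negPn/negP => aK.
  have := before_find d (index_ltn aB).
  by rewrite /= nth_index ?aK // (mem_take aB).
have B0 : B != [::].
  rewrite -size_eq0 size_takel ?find_size // -lt0n /m.
  by case: (s1) s1_0 s1K => //= x s' _ ->.
have [s2_0|s2_0] := eqVneq s2 [::].
  exists [:: (A, B)]; first by rewrite /runs /= A0 B0 AK BK.
  by rewrite /unruns /= cats0 As Bs s2_0 cats0.
have [||||CI rCI s2E] := IHN s2.
- apply: leq_trans sN; rewrite As Bs !size_cat.
  by rewrite addnA -[X in (X < _)%N]add0n ltn_add2r addn_gt0 lt0n size_eq0 A0.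
- by apply/eqP.
- have m_lt : (m < size s1)%N.
    by rewrite ltnNge; apply: contra s2_0 => m_ge; rewrite /s2 drop_oversize.
  move=> d'; rewrite -nth0 nth_drop addn0 (set_nth_default d) //.
  by have := @nth_find _ d (fun a => a \notin K) s1; rewrite has_find; apply.
- move=> d'; have := ls d'; rewrite As Bs !last_cat.
  by case: (s2) s2_0.
exists ((A, B) :: CI); first by rewrite /runs /= A0 B0 AK BK.
by rewrite /unruns /= -/(unruns CI) -s2E -catA -Bs.
Qed.

(** Rotate to an element outside [K], then move the trailing run outside [K] to the front: the list
    now starts outside [K] and ends inside it. *)
Lemma rotation_runs K s : (exists2 a, a \in s & a \in K) ->
  (exists2 a, a \in s & a \notin K) ->
  exists r CI, runs K CI /\ rot r s = unruns CI.
Proof.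
move=> [b bs bK] [a sa aK].
have [i t s_rot] := rot_to sa.
have bt : b \in a :: t by rewrite -s_rot mem_rot.
have hasK : has (mem K) (rev (a :: t)) by apply/hasP; exists b; rewrite ?mem_rev.
pose m := find (mem K) (rev (a :: t)).
pose v := rev (take m (rev (a :: t))); pose u := rev (drop m (rev (a :: t))).
have uv : a :: t = u ++ v by rewrite /u /v -rev_cat cat_take_drop revK.
have vK : all (fun x => x \notin K) v.
  rewrite all_rev; apply/allP => x xv; apply/negP => xK.
  have := before_find a (index_ltn xv).
  by rewrite /= nth_index ?xK // (mem_take xv).
have u_last d : last d u \in K.
  have -> : last d u = nth a (rev (a :: t)) m.
    by rewrite /u (drop_nth a) -?has_find // rev_cons last_rcons.
  exact: nth_find.
have u0 : u <> [::].
  by move=> e; have := u_last a; rewrite e (negPf aK).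
have [||| CI rCI sE] := @runs_exist K (v ++ u).
- by case: (v) (u) u0 => [|? ?] [].
- move=> d; case: (v) vK uv => [_ uE|x v' /= /andP [xK _] _] //=.
  by rewrite cats0 in uE; rewrite -uE.
- by move=> d; rewrite last_cat; exact: u_last.
exists (rot_add s i (size u)), CI; split=> //.
by rewrite -rot_rot_add s_rot uv rot_size_cat.
Qed.

Lemma eq_cat_le (T : Type) (s1 s2 s3 s4 : seq T) :
  s1 ++ s2 = s3 ++ s4 -> (size s1 <= size s3)%N ->
  exists2 w, s3 = s1 ++ w & s2 = w ++ s4.
Proof.
elim: s1 s3 => [|x s1 IH] [|y s3] //=; try by move=> *; exists [::].
  by move=> -> _; exists (y :: s3).
by case=> -> /IH {}IH; rewrite ltnS => /IH [w -> ->]; exists w.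
Qed.

Lemma runs_head K CI x W : runs K CI -> unruns CI = x :: W -> x \notin K.
Proof.
case: CI => [|[[|y A] B] CI] //.
by rewrite /runs /= => /andP [/and3P [_ /andP [yK _] _] _] [<- _].
Qed.

(** A contiguous piece inside [K] cannot cross a run outside [K], as these runs are nonempty. *)
Lemma run_infix K CI u t v : runs K CI -> unruns CI = u ++ t ++ v ->
  t <> [::] -> all (fun a => a \in K) t ->
  exists2 p, p \in CI & {subset t <= p.2}.
Proof.
elim: CI u => [|[A B] CI IH] u.
  by move=> _ /(congr1 size); rewrite !size_cat /=; case: t => //= x t; rewrite addnS.
rewrite /runs /= -/(runs K CI) => /andP [/and4P [A0 B0 AK BK] rCI].
rewrite /unruns /= -/(unruns CI) => sE t0 tK.
have [ABu|uAB] := leqP (size (A ++ B)) (size u).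
  have [w _ wE] := eq_cat_le sE ABu.
  by have [p pCI tp] := IH w rCI wE t0 tK; exists p; rewrite // inE pCI orbT.
exists (A, B); first exact: mem_head.
have [w ABE twE] := eq_cat_le (esym sE) (ltnW uAB).
have w0 : w <> [::] by move=> e; move: uAB; rewrite ABE e cats0 ltnn.
have [tw|wt] := leqP (size t) (size w).
  have [w' wE _] := eq_cat_le twE tw.
  move=> x xt; have : x \in A ++ B by rewrite ABE wE !mem_cat xt orbT.
  rewrite mem_cat => /orP [xA|//].
  by have := allP AK _ xA; rewrite (allP tK _ xt).
have [w' tE FE] := eq_cat_le (esym twE) (ltnW wt).
have w'0 : w' <> [::] by move=> e; move: wt; rewrite tE e cats0 ltnn.
case: CI rCI FE {IH sE twE} => [|[A' B'] CI] /=.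
  by move=> _ /(congr1 size); rewrite size_cat; case: (w') w'0.
rewrite /runs /= => /andP [/and4P [A'0 _ A'K _] _]; rewrite /unruns /=.
case: A' A'0 A'K => // x A' _ /= /andP [xK _].
case: w' w'0 tE => // y w' _ tE [xy _]; subst y.
by have := allP tK x; rewrite tE mem_cat mem_head orbT => /(_ isT); rewrite (negPf xK).
Qed.

Lemma run_unique CI p q a : uniq (unruns CI) -> p \in CI -> q \in CI ->
  a \in p.1 ++ p.2 -> a \in q.1 ++ q.2 -> p = q.
Proof.
elim: CI => [|p0 CI IH] //=; rewrite /unruns /= -/(unruns CI) cat_uniq.
move=> /and3P [_ /hasPn p0CI uCI].
have disj q' b : q' \in CI -> b \in q'.1 ++ q'.2 -> b \notin p0.1 ++ p0.2.
  move=> q'CI bq'; apply: p0CI; apply/flattenP; exists (q'.1 ++ q'.2) => //.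
  exact: (map_f (fun p => p.1 ++ p.2)).
rewrite !inE => /orP [/eqP ->|pCI] /orP [/eqP ->|qCI] ap aq //.
- by have := disj _ _ qCI aq; rewrite ap.
- by have := disj _ _ pCI ap; rewrite aq.
- exact: IH.
Qed.

Lemma runs_uniq K CI : uniq (unruns CI) -> runs K CI -> uniq CI.
Proof.
elim: CI => [|p0 CI IH] //=; rewrite /unruns /= -/(unruns CI) cat_uniq.
move=> /and3P [_ /hasPn p0CI uCI]; rewrite /runs /= => /andP [/and4P [A0 _ _ _] rCI].
rewrite IH // andbT; apply/negP => pCI.
case: p0 p0CI pCI A0 => [[|a A] B] //= p0CI pCI _.
have /p0CI : a \in unruns CI.
  apply/flattenP; exists ((a :: A) ++ B); last exact: mem_head.
  exact: (map_f (fun p => p.1 ++ p.2) pCI).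
by rewrite mem_head.
Qed.

Lemma cyclic_intervals_runs K s r CI : uniq s -> size s = n ->
  runs K CI -> rot r s = unruns CI ->
  perm_eq [seq [set a in p.2]%SET | p <- CI] (enum (cyclic_intervals s K)).
Proof.
move=> us sn rCI sE; rewrite -(cyclic_intervals_rot r) // sE.
have uU : uniq (unruns CI) by rewrite -sE rot_uniq.
have Un : size (unruns CI) = n by rewrite -sE size_rot.
have runP p : p \in CI -> exists2 a, a \in p.2 & all (fun a => a \in K) p.2.
  move=> pCI; have /and4P [_ + _ pK] := allP rCI p pCI.
  by case: (p.2) pK => // a B pK _; exists a; rewrite ?mem_head.
have run_sub p q : p \in CI -> q \in CI ->
    ([set a in p.2] \subset [set a in q.2])%SET -> p = q.
  move=> pCI qCI /fintype.subsetP pq; have [a ap _] := runP p pCI.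
  have aq : a \in q.2 by have := pq a; rewrite !inE; apply.
  by apply: (run_unique (a := a) uU pCI qCI); rewrite mem_cat ?ap ?aq orbT.
have run_cons p : p \in CI -> consecutive (unruns CI) [set a in p.2]%SET.
  move=> pCI; case/splitPr: pCI (runP p pCI) Un => CI1 CI2 [a ap _] Un.
  apply/(consecutiveP _ Un).
  have -> : unruns (CI1 ++ p :: CI2) = (unruns CI1 ++ p.1) ++ (p.2 ++ unruns CI2).
    by rewrite /unruns map_cat flatten_cat /= -!catA.
  exists (size (unruns CI1 ++ p.1)), p.2, (unruns CI2 ++ (unruns CI1 ++ p.1)).
  by rewrite rot_size_cat -!catA; split=> // e; rewrite e in ap.
have run_K p : p \in CI -> ([set a in p.2] \subset K)%SET.
  move=> pCI; have [_ _ pK] := runP p pCI.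
  by apply/fintype.subsetP => x; rewrite inE => /(allP pK).
have cons_run J : consecutive (unruns CI) J -> (J \subset K)%SET ->
    exists2 p, p \in CI & (J \subset [set a in p.2])%SET.
  move=> /(consecutiveP _ Un) [q [t [v [qE t0 ->]]]] /fintype.subsetP tK.
  have tK' : all (fun a => a \in K) t.
    by apply/allP => a at_; apply: tK; rewrite inE.
  suff [u [v' uE]] : exists u v', unruns CI = u ++ t ++ v'.
    have [p pCI tp] := run_infix rCI uE t0 tK'.
    by exists p => //; apply/fintype.subsetP => x; rewrite !inE; apply: tp.
  (* A piece running past the end of the list would contain its head, which is outside [K]. *)
  have [tq|qt] := leqP (size t) (size (drop q (unruns CI))).
    have [w wE _] := eq_cat_le (esym qE) tq.
    by exists (take q (unruns CI)), w; rewrite -wE cat_take_drop.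
  have [w tE wE] := eq_cat_le qE (ltnW qt).
  case: w tE wE => [tE|x w tE wE]; first by move: qt; rewrite tE cats0 ltnn.
  have /negP [] : x \notin K.
    apply: (runs_head rCI (W := w ++ v ++ drop q (unruns CI))).
    by rewrite -[LHS](cat_take_drop q) wE /= -catA.
  by apply: tK; rewrite inE tE mem_cat mem_head orbT.
apply: uniq_perm; rewrite ?enum_uniq //.
  rewrite map_inj_in_uniq ?(runs_uniq uU rCI) // => p q pCI qCI pq.
  by apply: run_sub => //; rewrite pq.
move=> J; rewrite mem_enum mem_cyclic_intervals; apply/mapP/maxsetP => [[p pCI ->]|].
  split=> [|B /andP [BK Bc] pB]; first by rewrite run_K ?run_cons.
  have [q qCI Bq] := cons_run _ Bc BK.
  have pq := run_sub _ _ pCI qCI (fintype.subset_trans pB Bq).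
  by apply/eqP; rewrite finset.eqEsubset pB pq Bq.
move=> [/andP [JK Jc] Jmax]; have [p pCI Jp] := cons_run _ Jc JK.
by exists p => //; rewrite -(Jmax [set a in p.2]%SET) // run_K ?run_cons.
Qed.

(* The pairs of (A, B) :: CI with the roles of the two kinds of runs exchanged,
   the cycle starting at B instead of A. *)
Fixpoint shift_runs A B CI : seq (seq 'I_n * seq 'I_n) :=
  match CI with
  | [::] => [:: (B, A)]
  | p :: CI' => (B, p.1) :: shift_runs A p.2 CI'
  end.

Lemma unruns_shift A B CI : unruns (shift_runs A B CI) = B ++ unruns CI ++ A.
Proof.
elim: CI B => [|p CI IH] B; first by rewrite /unruns /= cats0.
by rewrite /unruns /= -!/(unruns _) IH -!catA.
Qed.

Lemma runs_shift K A B CI :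
  runs K ((A, B) :: CI) -> runs (~: K)%SET (shift_runs A B CI).
Proof.
elim: CI A B => [|[A' B'] CI IH] A B.
  rewrite /runs /= !andbT => /and4P [-> -> AK BK] /=.
  by apply/andP; split; apply/allP => x; [move/(allP BK)|move/(allP AK)];
    rewrite inE ?negbK.
rewrite /runs /= -!/(runs _ _) => /andP [/and4P [A0 B0 AK BK]].
move=> /andP [/and4P [A'0 B'0 A'K B'K] rCI].
rewrite B0 A'0 IH; last by rewrite /runs /= A0 B'0 AK B'K.
by rewrite andbT /=; apply/andP; split; apply/allP => x;
  [move/(allP BK)|move/(allP A'K)]; rewrite inE ?negbK.
Qed.

Lemma map_shift A B CI :
  [seq p.2 | p <- shift_runs A B CI] = rcons [seq p.1 | p <- CI] A.
Proof. by elim: CI B => //= p CI IH B; rewrite IH. Qed.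

(** For the complement, the cycle is started at the first run inside [I], where [shift_runs]
    applies. *)
Lemma runs_interlacing I s r CI : uniq s -> size s = n -> CI <> [::] ->
  runs I CI -> rot r s = unruns CI -> interlacing s I CI.
Proof.
move=> us sn CI0 rCI sE; split; first by exists r.
  exact: cyclic_intervals_runs rCI sE.
case: CI CI0 rCI sE => // [[A B] CI] _ rCI sE.
have sE' : rot (rot_add s r (size A)) s = unruns (shift_runs A B CI).
  rewrite -rot_rot_add sE unruns_shift /unruns /= -/(unruns CI) -catA.
  by rewrite rot_size_cat catA.
have := cyclic_intervals_runs us sn (runs_shift rCI) sE'.
rewrite (map_comp (fun t => [set a in t]%SET) (fun p => p.2)) map_shift map_rcons.
rewrite -map_comp; apply: perm_trans.
by rewrite /= perm_sym perm_rcons.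
Qed.

(** This makes the results on runs available for an arbitrary interlacing: cyclic intervals of a set
    are nonempty and contained in it. *)
Lemma interlacing_runs I s CI : size s = n -> interlacing s I CI -> runs I CI.
Proof.
move=> sn [_ permI permC].
have nonempty (K : {set 'I_n}) t : [set a in t]%SET \in cyclic_intervals s K ->
    t != [::] /\ all (fun a => a \in K) t.
  rewrite mem_cyclic_intervals => /maxsetP [/andP [/fintype.subsetP tK]].
  move=> /(consecutiveP _ sn) [q [t' [v [_ t'0 tE]]]] _; split.
    apply/eqP => e; case: t' t'0 tE => // x t' _ /setP /(_ x).
    by rewrite e !inE eqxx.
  by apply/allP => a at_; apply: tK; rewrite inE.
apply/allP => p pCI.
have [|p1 p1K] := nonempty (~: I)%SET p.1.
  by rewrite -mem_enum -(perm_mem permC); apply/mapP; exists p.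
have [|p2 p2K] := nonempty I p.2.
  by rewrite -mem_enum -(perm_mem permI); apply/mapP; exists p.
rewrite p1 p2 p2K andbT /=; apply/allP => a /(allP p1K); by rewrite inE.
Qed.

End Runs.

(** * The translated blade *)

Lemma blade_cones_rot (R : realType) (n : nat) k r (d : decorated n) :
  blade_cones R k (rot r d) = blade_cones R k d.
Proof.
have sub r' (d' : decorated n) : blade_cones R k (rot r' d') `<=` blade_cones R k d'.
  move=> _ [j /= jd <-]; rewrite size_rot in jd; rewrite rot_rot_add.
  (* [rot_add] may return the full length, which is not an index of the family but gives the same
     rotation as 0. *)
  have := leq_rot_add r' j d'; rewrite leq_eqVlt => /orP [/eqP ->|lt].
    rewrite rot_size -[X in cone _ _ X]rot0; exists 0%N => //=.
    exact: leq_ltn_trans jd.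
  by exists (rot_add d' r' j).
apply/seteqP; split; first exact: sub.
by rewrite -[X in blade_cones _ _ X `<=` _](rotK r); apply: sub.
Qed.

(** A small push of coordinate [a] out of [0, 1], compensated at another coordinate, leaves the
    hypersimplex within the hyperplane. *)
Lemma rel_boundary_hypersimplex (R : realType) (n k : nat) (y : 'rV[R]_n) a c :
  (1 < n)%N -> hypersimplex R n k y -> y 0 a = c -> c = 0 \/ c = 1 ->
  rel_boundary (hyperplane R n k) (hypersimplex R n k) y.
Proof.
move=> n1 Dy ya c01; split; first split.
- exact: Dy.2.
- exact: subset_closure.
apply/closure_rowP => e e0.
have [b ba] : exists b : 'I_n, b != a.
  have : (0 < #|[set~ a]%SET|)%N by rewrite cardsC1 card_ord; lia.
  by case/card_gt0P => b; rewrite !inE; exists b.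
pose t := if c == 0 then - (e / 2) else e / 2.
have te : `|t| < e.
  by rewrite /t; case: ifP => _; rewrite ?normrN ger0_norm ?divr_ge0 ?(ltW e0) //; lra.
pose v : 'rV[R]_n := delta_mx 0 a - delta_mx 0 b.
exists (y + t *: v); last first.
  move=> i; rewrite !mxE opprD addrA subrr add0r normrN normrM.
  apply: le_lt_trans te; rewrite ler_piMr //=.
  by case: (i == a); case: (i == b); rewrite ?subrr ?subr0 ?sub0r ?normrN ?normr0 ?normr1.
split.
  have Hy : \sum_i y 0 i = (k%:Z)%:~R := Dy.2.
  rewrite /hyperplane /= -Hy !sum_lform lformD lformZ lformB -!sum_lform.
  have sum_delta j : \sum_i (delta_mx 0 j : 'rV[R]_n) 0 i = 1.
    rewrite (bigD1 j) //= mxE !eqxx big1 ?addr0 // => i /negPf ij.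
    by rewrite mxE ij andbF.
  by rewrite !sum_delta subrr mulr0 addr0.
move=> [/(_ a) + _]; rewrite !mxE !eqxx eq_sym (negPf ba) /= subr0 mulr1 ya /t.
by case: c01 => ->; rewrite ?eqxx ?oner_eq0; lra.
Qed.

(** * Minima of prefix sums along the cycle *)

Section Excess.
Context (R : realType) (n : nat) (I : {set 'I_n}).
Implicit Types (y : 'rV[R]_n) (L : seq 'I_n).

Definition fsum y L : R := \sum_(a <- L) (y 0 a - (a \in I)%:R).

Definition box y : Prop := forall a, 0 <= y 0 a <= 1.

Lemma fsum_cat y L L' : fsum y (L ++ L') = fsum y L + fsum y L'.
Proof. by rewrite /fsum big_cat. Qed.

Lemma fsum_ge0 y L : box y -> all (fun a => a \notin I) L -> 0 <= fsum y L.
Proof.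
move=> by_ /allP LI; rewrite /fsum big_seq; apply: sumr_ge0 => a /LI /negPf ->.
by rewrite subr0; case/andP: (by_ a).
Qed.

Lemma fsum_le0 y L : box y -> all (fun a => a \in I) L -> fsum y L <= 0.
Proof.
move=> by_ /allP LI; rewrite /fsum big_seq; apply: sumr_le0 => a /LI ->.
by rewrite subr_le0; case/andP: (by_ a).
Qed.

Definition breakpoint (CI : seq (seq 'I_n * seq 'I_n)) i :=
  size (unruns (take i CI)).

(* Along the cycle fsum increases on the runs outside I and decreases on the
   runs inside I, so it is minimal at the starts of the former. *)
Lemma fsum_min_breakpoint CI t : runs I CI -> (t <= size (unruns CI))%N ->
  exists i, [/\ (i <= size CI)%N,
    forall y, box y -> fsum y (take (breakpoint CI i) (unruns CI))
                       <= fsum y (take t (unruns CI))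
    & t = breakpoint CI i \/
      exists a c, (c = 0 \/ c = 1 :> R) /\
        forall y, box y -> fsum y (take t (unruns CI))
                    <= fsum y (take (breakpoint CI i) (unruns CI)) -> y 0 a = c].
Proof.
elim: CI t => [|[A B] CI IH] t.
  by move=> _; rewrite leqn0 => /eqP ->; exists 0%N; split=> //; left.
rewrite /runs /= -/(runs I CI) => /andP [/and4P [A0 B0 AI BI] rCI] tn.
have uE : unruns ((A, B) :: CI) = A ++ B ++ unruns CI by rewrite /unruns /= catA.
have bE i : breakpoint ((A, B) :: CI) i.+1 = (size A + size B + breakpoint CI i)%N.
  by rewrite /breakpoint /= /unruns /= !size_cat.
rewrite uE !size_cat in tn *.
(* Inside the run [A] the competitor is its start, and a tie forces the first coordinate of [A] to
   be 0. *)
have [tA|At] := leqP t (size A).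
  exists 0%N; have -> : breakpoint ((A, B) :: CI) 0 = 0%N by [].
  rewrite take0; have f0 y : fsum y [::] = 0 by rewrite /fsum big_nil.
  rewrite takel_cat //; have tAI : all (fun a => a \notin I) (take t A).
    by apply/allP => a /mem_take; apply: (allP AI).
  split=> // [y by_|]; first by rewrite f0 fsum_ge0.
  case: t tA tn tAI => [|t] tA tn tAI; [by left|right].
  case: A A0 AI tA tAI {uE bE tn} => // a A _ /= /andP [aI _] tA /andP [_ tAI].
  exists a, 0; split; first by left.
  move=> y by_; rewrite f0 -cat1s fsum_cat => le0.
  have := fsum_ge0 by_ tAI; move: le0; rewrite /fsum big_seq1 (negPf aI) subr0.
  by case/andP: (by_ a) => *; apply: le_anti; apply/andP; split=> //; lra.
(* Inside the run [B] the competitor is its end, and a tie forces the coordinate at position t to be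
   1. *)
have [tB|Bt] := ltnP t (size A + size B)%N.
  exists 1%N; rewrite bE /breakpoint take0 /= addn0.
  have t1 : take (size A + size B) (A ++ B ++ unruns CI) = A ++ B.
    by rewrite catA take_size_cat // size_cat.
  have tBs : (t - size A <= size B)%N by lia.
  have t2 : take t (A ++ B ++ unruns CI) = A ++ take (t - size A) B.
    by rewrite take_cat ltnNge (ltnW At) /= takel_cat.
  have fE y : fsum y (A ++ B) = fsum y (A ++ take (t - size A) B)
                               + fsum y (drop (t - size A) B).
    by rewrite -fsum_cat -catA cat_take_drop.
  rewrite t1 t2; have dI : all (fun a => a \in I) (drop (t - size A) B).
    by apply/allP => a /mem_drop; apply: (allP BI).
  split=> // [y by_|]; first by rewrite fE gerDl fsum_le0.
  right; case dE: (drop (t - size A) B) dI => [|a L] /=.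
    by move/(congr1 size): dE; rewrite size_drop /=; lia.
  move=> /andP [aI LI]; exists a, 1; split; first by right.
  move=> y by_; rewrite fE dE lerDl -cat1s fsum_cat /fsum big_seq1 aI /=.
  rewrite -/(fsum y L) => ge0; have := fsum_le0 by_ LI.
  case/andP: (by_ a) => *; apply: le_anti; apply/andP; split=> //.
  by lra.
have [|i [il le_i tie]] := IH (t - (size A + size B))%N rCI.
  by rewrite leq_subLR -addnA.
have tkE m : take (size A + size B + m) (A ++ B ++ unruns CI) =
    (A ++ B) ++ take m (unruns CI).
  rewrite catA take_cat size_cat ltnNge leq_addr /= addKn //.
have tE : take t (A ++ B ++ unruns CI) =
    (A ++ B) ++ take (t - (size A + size B)) (unruns CI) by rewrite -tkE subnKC.
exists i.+1; rewrite bE tkE tE.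
split=> // [y by_|]; first by rewrite !fsum_cat lerD2l le_i.
case: tie => [iE|[a [c [c01 ac]]]]; first by left; rewrite -iE subnKC.
by right; exists a, c; split=> // y by_; rewrite !fsum_cat lerD2l; apply: ac.
Qed.

End Excess.

Section TranslatedBlade.
Context (R : realType) (n : nat) (I : {set 'I_n}).
Implicit Types (s : seq 'I_n) (y : 'rV[R]_n).

Definition singleton_blocks s : seq (seq 'I_n * int) := [seq ([:: a], 0) | a <- s].

Lemma singletonsE s : Defs.singletons s = deco (singleton_blocks s).
Proof.
rewrite /deco /singleton_blocks -map_comp; apply: eq_map => a /=.
by congr (_, _); apply/setP => b; rewrite !inE.
Qed.

Lemma flatten_singleton_blocks s :
  flatten [seq p.1 | p <- singleton_blocks s] = s.
Proof. by rewrite -map_comp (flatten_map1 id) map_id. Qed.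

Lemma sum_singleton_blocks s : \sum_(p <- singleton_blocks s) p.2 = 0.
Proof. by rewrite big_map big1. Qed.

Definition tcone s (j : nat) : set 'rV[R]_n :=
  [set y | hyperplane R n #|I| y /\
     forall t, (t < n)%N -> fsum I y (take j s) <= fsum I y (take t s)].

Lemma mem_translate (p : 'rV[R]_n) (A : set 'rV[R]_n) y :
  translate p A y <-> A (y - p).
Proof.
split=> [[x Ax <-]|Ay]; first by rewrite addrK.
by exists (y - p) => //; rewrite subrK.
Qed.

Lemma sum_evec : \sum_i evec R I 0 i = #|I|%:R.
Proof.
rewrite -sum1_card natr_sum [RHS]big_mkcond.
by apply: eq_bigr => a _; rewrite mxE; case: (_ \in _).
Qed.

Lemma hyperplane_translate y :
  hyperplane R n 0 (y - evec R I) <-> hyperplane R n #|I| y.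
Proof.
rewrite /hyperplane /=; have -> : \sum_i (y - evec R I) 0 i = \sum_i y 0 i - #|I|%:R.
  by rewrite -sum_evec -sumrB; apply: eq_bigr => a _; rewrite !mxE.
split=> [/eqP|->]; last by rewrite subrr.
by rewrite subr_eq0 => /eqP.
Qed.

Lemma pot_singletons s y t : uniq s -> (t <= size s)%N ->
  pot (block_of (singleton_blocks s)) (weight R (singleton_blocks s)) (y - evec R I) t
  = fsum I y (take t s).
Proof.
move=> us ts; rewrite pot_excess ?flatten_singleton_blocks ?size_map //.
rewrite -map_take big_map; apply: eq_bigr => a _.
by rewrite /excess big_seq1 /= subr0 !mxE.
Qed.

Lemma mem_tcone s j y : uniq s -> size s = n -> (j < n)%N ->
  pot_cone (block_of (singleton_blocks s)) 0 n (weight R (singleton_blocks s)) j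
    (y - evec R I) <-> tcone s j y.
Proof.
move=> us sn jn; split=> -[/hyperplane_translate Hy le_j]; split=> // t tn.
  by rewrite -!pot_singletons ?sn 1?ltnW //; apply: le_j.
by rewrite !pot_singletons ?sn 1?ltnW //; apply: le_j.
Qed.

Lemma mem_full s a : uniq s -> size s = n -> a \in s.
Proof.
move=> us sn; have sE : #|s| = #|'I_n| by rewrite card_ord (card_uniqP us).
by have /(subset_cardP sE) -> := subset_predT (mem s).
Qed.

Lemma cone_singletons s j : uniq s -> size s = n -> (j < n)%N ->
  cone R 0 (rot j (Defs.singletons s)) =
  pot_cone (block_of (singleton_blocks s)) 0 n (weight R (singleton_blocks s)) j.
Proof.
move=> us sn jn; rewrite singletonsE cone_deco ?size_map ?sn //.
- by rewrite flatten_singleton_blocks.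
- by move=> a; rewrite flatten_singleton_blocks mem_full.
- exact: sum_singleton_blocks.
Qed.

Lemma translate_cone s j : uniq s -> size s = n -> (j < n)%N ->
  translate (evec R I) (cone R 0 (rot j (Defs.singletons s))) = tcone s j.
Proof.
move=> us sn jn; rewrite cone_singletons //.
apply/seteqP; split=> y; first by move=> /mem_translate/mem_tcone; apply.
by move=> /mem_tcone/mem_translate; apply.
Qed.

Lemma translated_cones_rot r s :
  translated_cones (rot r s) (evec R I) = translated_cones s (evec R I).
Proof. by rewrite /translated_cones /Defs.singletons map_rot blade_cones_rot. Qed.

Lemma translated_blade_rot r s :
  translated_blade (rot r s) (evec R I) = translated_blade s (evec R I).
Proof. by rewrite /translated_blade /blade /Defs.singletons map_rot blade_cones_rot. Qed.

Lemma translated_conesE s : uniq s -> size s = n ->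
  translated_cones s (evec R I) = [set tcone s j | j in `I_n].
Proof.
move=> us sn; apply/seteqP; split.
  move=> _ [_ [j /= jn <-] <-]; rewrite size_map sn in jn.
  by exists j => //; rewrite translate_cone.
move=> _ [j /= jn <-]; rewrite -translate_cone //.
by exists (cone R 0 (rot j (Defs.singletons s))) => //; exists j; rewrite //= size_map sn.
Qed.

Lemma mem_translated_blade s y : uniq s -> size s = n ->
  translated_blade s (evec R I) y <->
  exists j t, [/\ (j < n)%N, (t < n)%N, t != j, tcone s j y
    & fsum I y (take t s) = fsum I y (take j s)].
Proof.
move=> us sn.
have surj j : (j < n)%N -> exists b, block_of (singleton_blocks s) b = j.
  move=> jn; have [b] : exists b, b \in (nth ([::], 0) (singleton_blocks s) j).1.
    case: (s) sn => [|a s'] sn; first by rewrite -sn in jn.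
    exists (nth a (a :: s') j).
    by rewrite /singleton_blocks (nth_map a) ?sn // mem_head.
  rewrite -block_ofP ?flatten_singleton_blocks ?size_map ?sn // => /eqP.
  by exists b.
split.
  move=> /mem_translate [_ [j /= jn <-]]; rewrite size_map sn in jn.
  rewrite cone_singletons // rel_boundary_pot_cone //.
  move=> [/mem_tcone tj [t [tn tj' eqt]]].
  exists j, t; split=> //; first exact: tj.
  by rewrite -!pot_singletons ?sn 1?ltnW.
move=> [j [t [jn tn tj /mem_tcone cj eqt]]]; apply/mem_translate.
exists (cone R 0 (rot j (Defs.singletons s))); first by exists j; rewrite //= size_map sn.
rewrite cone_singletons // rel_boundary_pot_cone //; split; first exact: cj.
by exists t; split=> //; rewrite !pot_singletons ?sn 1?ltnW.
Qed.

(** After rotating the cycle to start at j, minimality at 0 says that the prefix sums of y dominate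
    those of e_I. *)
Lemma tcone_matroid s j : uniq s -> size s = n -> (j < n)%N ->
  is_matroid_polytope #|I| (hypersimplex R n #|I| `&` tcone s j).
Proof.
move=> us sn jn; pose s' := rot j s; pose pos (a : 'I_n) := index a s'.
have us' : uniq s' by rewrite rot_uniq.
have sn' : size s' = n by rewrite size_rot.
have pos_inj : injective pos.
  by move=> a b; apply: index_inj; rewrite ?mem_full.
have fsumE y t : (fsum I y (take t s') = lpot pos y t - lpot pos (evec R I) t).
  rewrite /lpot -lformB -/(lpot _ _ _) lpotE /fsum big_uniq ?take_uniq //.
  apply: eq_big => [a|a _]; last by rewrite !mxE.
  by rewrite in_take // mem_full.
suff -> : hypersimplex R n #|I| `&` tcone s j = @gale_polytope R n #|I| pos I.
  exact: gale_polytope_matroid.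
have -> : tcone s j = tcone s' 0.
  by rewrite -!translate_cone ?(leq_ltn_trans _ jn) // /s' /Defs.singletons map_rot rot0.
(* [gale_polytope] quantifies over all prefix lengths, the cone only over those below n; from n on
   both sums are the total. *)
have lpot_full (y : 'rV[R]_n) t : (n <= t)%N -> lpot pos y t = \sum_a y 0 a.
  move=> nt; rewrite lpotE; apply: eq_bigl => a.
  by apply: leq_trans nt; rewrite /pos -[leqRHS]sn' index_mem mem_full.
apply/seteqP; split=> [y [Dy [Hy le0]]|y [Dy le_pot]]; split=> //.
  move=> t; have [tn|nt] := ltnP t n.
    by have := le0 t tn; rewrite take0 {1}/fsum big_nil fsumE subr_ge0.
  by rewrite !lpot_full // sum_evec Dy.2.
split; first exact: Dy.2.
by move=> t tn; rewrite take0 {1}/fsum big_nil fsumE subr_ge0.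
Qed.

End TranslatedBlade.

(** * Comparison of the two fans on the hypersimplex *)

Section Interlaced.
Context (R : realType) (n k r : nat) (sigma : seq 'I_n) (I : {set 'I_n}).
Context (CI : seq (seq 'I_n * seq 'I_n)).
Hypothesis n_gt1 : (1 < n)%N.
Hypothesis sigma_uniq : uniq sigma.
Hypothesis sigma_size : size sigma = n.
Hypothesis card_I : #|I| = k.
Hypothesis CI_runs : runs I CI.
Hypothesis CI_rot : rot r sigma = unruns CI.

Let s := unruns CI.
Let l := size CI.
Let Delta := hypersimplex R n k.
Let D : seq (seq 'I_n * int) := [seq (p.1 ++ p.2, (size p.2)%:Z) | p <- CI].
Let d := interlaced_dosp CI.
Let blk := block_of D.
Let sc (j : nat) : nat := size (nth ([::], [::]) CI j).2.
Let c (j : nat) : R := (sc j)%:R.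
Let Q (a : nat) : set 'rV[R]_n := cell k l blk sc (pred1 a).
Let b := breakpoint CI.
Let f (y : 'rV[R]_n) (t : nat) : R := fsum I y (take t s).

Lemma unruns_uniq : uniq s. Proof. by rewrite /s -CI_rot rot_uniq. Qed.

Lemma unruns_size : size s = n. Proof. by rewrite /s -CI_rot size_rot. Qed.

Lemma mem_runs p : p \in CI -> [/\ p.1 != [::], p.2 != [::],
  forall a, a \in p.1 -> a \notin I & forall a, a \in p.2 -> a \in I].
Proof. by move=> /(allP CI_runs) /and4P [? ? /allP ? /allP ?]. Qed.

Lemma flatten_blocks : flatten [seq p.1 | p <- D] = s.
Proof. by rewrite -map_comp. Qed.

Lemma subseq_unruns p : p \in CI -> subseq (p.1 ++ p.2) s.
Proof.
rewrite /s; elim: (CI) => //= p' CI' IH; rewrite inE /unruns /= => /orP [/eqP ->|pCI].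
  exact: prefix_subseq.
by apply: subseq_trans (IH pCI) _; apply: suffix_subseq.
Qed.

Lemma interlaced_dospE : d = deco D.
Proof.
rewrite /d /interlaced_dosp /deco -map_comp; apply/eq_in_map => p pCI /=.
congr (_, _); first by apply/setP => a; rewrite !inE mem_cat orbC.
have := subseq_uniq (subseq_unruns pCI) unruns_uniq; rewrite cat_uniq => /and3P [_ _ up].
by rewrite cardsE (card_uniqP up).
Qed.

Lemma weight_blocks : weight R D = c.
Proof.
apply/funext => j; rewrite /weight /c /sc -map_comp.
have [jl|lj] := ltnP j l; first by rewrite (nth_map ([::], [::])).
by rewrite !nth_default ?size_map.
Qed.

Lemma size_blocks : size D = l. Proof. by rewrite size_map. Qed.

Lemma sum_run_sizes : (\sum_(j < l) sc j)%N = k.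
Proof.
rewrite -card_I.
have -> : #|I| = count (mem I) s.
  rewrite -size_filter; have /card_uniqP <- := filter_uniq (mem I) unruns_uniq.
  by apply: eq_card => a; rewrite mem_filter mem_full ?unruns_uniq ?unruns_size // andbT.
have count_run p : p \in CI -> count (mem I) (p.1 ++ p.2) = size p.2.
  move=> /mem_runs [_ _ p1 p2]; rewrite count_cat -[RHS]add0n; congr addn.
    by apply/eqP; rewrite -leqn0 leqNgt -has_count; apply/hasPn => a /p1.
  by apply/eqP; rewrite -all_count; apply/allP => a /p2.
rewrite /s /unruns count_flatten sumnE !big_map.
rewrite (big_nth ([::], [::])) big_mkord; apply: eq_bigr => j _.
by rewrite count_run ?mem_nth.
Qed.

Lemma sum_block_weights : \sum_(p <- D) p.2 = k.
Proof.
rewrite big_map -sum_run_sizes (big_nth ([::], [::])) big_mkord.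
by rewrite -[RHS]/((_)%:Z) (big_morph Posz PoszD (erefl _)).
Qed.

Lemma block_lt a : (blk a < l)%N.
Proof.
rewrite -size_blocks /blk /block_of -has_find.
have : a \in s by rewrite mem_full ?unruns_uniq ?unruns_size.
rewrite -flatten_blocks => /flattenP [_ /mapP [p pD ->] ap].
by apply/hasP; exists p.
Qed.

Lemma mem_block j a : (j < l)%N ->
  (blk a == j) = (a \in (nth ([::], [::]) CI j).1 ++ (nth ([::], [::]) CI j).2).
Proof.
move=> jl; rewrite (block_ofP _ ([::], 0)) ?flatten_blocks ?unruns_uniq ?size_blocks //.
by rewrite (nth_map ([::], [::])).
Qed.

Lemma run_size_bounds j : (j < l)%N -> (0 < sc j < #|[set a | blk a == j]%SET|)%N.
Proof.
move=> jl; have pCI := mem_nth ([::], [::]) jl.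
have [p1 p2 _ _] := mem_runs pCI.
have -> : #|[set a | blk a == j]%SET| =
    size ((nth ([::], [::]) CI j).1 ++ (nth ([::], [::]) CI j).2).
  rewrite -(card_uniqP (subseq_uniq (subseq_unruns pCI) unruns_uniq)) cardsE.
  by apply: eq_card => a; rewrite -mem_block.
by rewrite size_cat -[X in (_ < X < _)%N]add0n ltn_add2r !lt0n !size_eq0 p1 p2.
Qed.

(** The link between the two fans: s_j counts the elements of [I] in block j, so subtracting the
    weights amounts to subtracting e_I. *)
Lemma pot_breakpoint y i : (i <= l)%N -> pot blk c y i = f y (b i).
Proof.
move=> il; rewrite -weight_blocks pot_excess ?flatten_blocks ?unruns_uniq ?size_blocks //.
rewrite /f; have -> : take (b i) s = unruns (take i CI).
  have -> : s = unruns (take i CI) ++ unruns (drop i CI).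
    by rewrite /unruns -flatten_cat -map_cat cat_take_drop.
  by rewrite take_size_cat.
rewrite /fsum /unruns big_flatten /= big_map /D -map_take big_map.
rewrite big_seq [RHS]big_seq; apply: eq_bigr => p /mem_take pCI.
have [_ _ p1 p2] := mem_runs pCI.
rewrite /excess /= sumrB; congr (_ - _).
rewrite big_cat /= big_seq big1 ?add0r => [|a /p1 /negPf ->] //.
rewrite big_seq (eq_bigr (fun=> 1)) => [|a /p2 ->] //.
by rewrite -big_seq big_const_seq count_predT iter_addr addr0.
Qed.

Lemma breakpoint0 : b 0 = 0%N. Proof. by rewrite /b /breakpoint take0. Qed.

Lemma breakpoint_last : b l = n.
Proof. by rewrite /b /breakpoint take_size unruns_size. Qed.

Lemma breakpoint_lt i j : (i < j <= l)%N -> (b i < b j)%N.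
Proof.
move=> /andP [ij jl]; rewrite /b /breakpoint.
have il : (i < l)%N := leq_trans ij jl.
have -> : take j CI =
    take i CI ++ nth ([::], [::]) CI i :: take (j - i.+1) (drop i.+1 CI).
  rewrite -{1}(subnKC (ltnW ij)) takeD (drop_nth ([::], [::]) il).
  by rewrite -(prednK (_ : 0 < j - i)%N) ?subn_gt0 // /= subnS.
rewrite /unruns map_cat flatten_cat size_cat /= !size_cat.
have [p1 _ _ _] := mem_runs (mem_nth ([::], [::]) il).
by rewrite -[X in (X < _)%N]addn0 ltn_add2l !addn_gt0 lt0n size_eq0 p1.
Qed.

Lemma breakpoint_lt_n i : (i < l)%N -> (b i < n)%N.
Proof. by move=> il; rewrite -breakpoint_last breakpoint_lt // il leqnn. Qed.

Lemma fsum_full y : hyperplane R n k y -> f y n = 0.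
Proof.
move=> Hy; rewrite /f take_oversize ?unruns_size // /fsum big_uniq ?unruns_uniq //=.
rewrite (eq_bigl predT) => [|a]; last by rewrite mem_full ?unruns_uniq ?unruns_size.
have cardE : \sum_a (a \in I)%:R = k%:R :> R.
  rewrite -card_I -sum1_card natr_sum [RHS]big_mkcond.
  by apply: eq_bigr => a _; case: (_ \in _).
by rewrite sumrB Hy cardE subrr.
Qed.

Lemma fsum_take0 y : f y 0 = 0. Proof. by rewrite /f take0 /fsum big_nil. Qed.

Lemma hypersimplex_box y : Delta y -> box y. Proof. by case. Qed.

Lemma runs_gt0 : (0 < l)%N.
Proof. exact: leq_ltn_trans (leq0n _) (block_lt (Ordinal n_gt1)). Qed.

(* Breakpoint l is the same point of the cycle as breakpoint 0. *)
Lemma fsum_min y t : Delta y -> (t <= n)%N ->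
  exists2 i, (i < l)%N & f y (b i) <= f y t.
Proof.
move=> Dy tn; have ts : (t <= size (unruns CI))%N by rewrite unruns_size.
have [i [il le_i _]] := fsum_min_breakpoint R CI_runs ts.
have {}le_i : f y (b i) <= f y t := le_i _ (hypersimplex_box Dy).
move: il; rewrite leq_eqVlt => /orP [/eqP i_l|il]; last by exists i.
exists 0%N; first exact: runs_gt0.
by move: le_i; rewrite i_l breakpoint_last (fsum_full Dy.2) breakpoint0 fsum_take0.
Qed.

Lemma tcone_cell a : (a < l)%N -> Delta `&` tcone I s (b a) = Q a.
Proof.
move=> al; apply/seteqP; split=> y.
  move=> [Dy [Hy le_t]]; split=> // i j il jl /eqP ->.
  by rewrite !pot_breakpoint 1?ltnW //; apply: le_t; apply: breakpoint_lt_n.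
move=> [Dy le_i]; split=> //; split; first by rewrite card_I; case: Dy.
move=> t tn; have [i il le_t] := fsum_min Dy (ltnW tn).
apply: le_trans le_t; rewrite -/(f y (b a)) -!pot_breakpoint 1?ltnW //.
exact: (le_i a i al il (eqxx a)).
Qed.

Lemma cell_matroid a : (a < l)%N -> is_matroid_polytope k (Q a).
Proof.
move=> al; rewrite -tcone_cell // /Delta -card_I.
by apply: tcone_matroid; rewrite ?unruns_uniq ?unruns_size ?breakpoint_lt_n.
Qed.

(** The coordinate and its value depend on t alone, so the whole intersection of this cone with the
    hypersimplex lies in one hyperplane x_a = e and yields no maximal cell. *)
Lemma tcone_off_breakpoint t : (t < n)%N -> (forall i, (i < l)%N -> t <> b i) ->
  exists a e, (e = 0 \/ e = 1 :> R) /\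
    forall y, Delta y -> tcone I s t y -> y 0 a = e.
Proof.
move=> tn t_nb; have ts : (t <= size (unruns CI))%N by rewrite unruns_size ltnW.
have [i [il _ [tb|[a [e [e01 ae]]]]]] := fsum_min_breakpoint R CI_runs ts.
  have {}tb : t = b i := tb.
  move: il; rewrite leq_eqVlt => /orP [/eqP i_l|/t_nb //].
  by move: tn; rewrite tb i_l breakpoint_last ltnn.
exists a, e; split=> // y Dy [Hy le_t]; apply: ae; first exact: hypersimplex_box.
have {}le_t u : (u < n)%N -> f y t <= f y u by exact: le_t.
rewrite -/(f y t) -/(f y (b i)).
move: il; rewrite leq_eqVlt => /orP [/eqP ->|/breakpoint_lt_n /le_t //].
rewrite breakpoint_last (fsum_full Dy.2) -(fsum_take0 y); apply: le_t.
exact: leq_ltn_trans tn.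
Qed.

Lemma has_dim_run_cell a : (a < l)%N -> has_dim (Q a) (n - 1).
Proof.
move=> al; apply: has_dim_cell1 => //; first exact: ltnW.
- exact: block_lt.
- exact: run_size_bounds.
- exact: sum_run_sizes.
Qed.

Lemma translated_cells :
  induced_subdivision Delta (translated_cones sigma (evec R I)) = @cells R n k l blk sc.
Proof.
rewrite -(translated_cones_rot _ _ r) CI_rot.
rewrite translated_conesE ?unruns_uniq ?unruns_size //.
apply/seteqP; split.
  move=> _ [_ [[t /= tn <-] dimC] <-].
  have [[i [il tb]]|t_nb] := pselect (exists i, (i < l)%N /\ t = b i).
    by exists i => //; rewrite tb tcone_cell.
  have [|a [e [_ ae]]] := @tcone_off_breakpoint t tn.
    by move=> i il tb; apply: t_nb; exists i.
  exfalso; apply: (@not_has_dim_facet _ _ _ a e k%:R n_gt1 _ dimC) => y [Dy ty].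
  by split; [exact: ae | case: Dy].
move=> _ [a /= al <-]; exists (tcone I s (b a)); last by rewrite tcone_cell.
split; last by rewrite tcone_cell //; exact: has_dim_run_cell.
by exists (b a) => //=; apply: breakpoint_lt_n.
Qed.

Lemma cone_interlaced j : (j < l)%N ->
  cone R k (rot j d) = pot_cone blk k l c j.
Proof.
move=> jl; rewrite interlaced_dospE cone_deco ?size_blocks ?weight_blocks //.
- by rewrite flatten_blocks unruns_uniq.
- by move=> a; rewrite flatten_blocks mem_full ?unruns_uniq ?unruns_size.
- exact: sum_block_weights.
Qed.

Lemma pot_cone_cell a : (a < l)%N -> Delta `&` pot_cone blk k l c a = Q a.
Proof.
move=> al; apply/seteqP; split=> y.
  by move=> [Dy [_ le_i]]; split=> // i j il jl /eqP ->; apply: le_i.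
move=> [Dy le_i]; split=> //; split; first by case: Dy.
by move=> i il; apply: le_i => /=.
Qed.

Lemma size_interlaced_dosp : size d = l.
Proof. by rewrite interlaced_dospE size_map size_blocks. Qed.

Lemma blade_cells :
  induced_subdivision Delta (blade_cones R k d) = @cells R n k l blk sc.
Proof.
apply/seteqP; split.
  move=> _ [_ [[j /= jl <-] _] <-]; rewrite size_interlaced_dosp in jl.
  by exists j => //; rewrite cone_interlaced // pot_cone_cell.
move=> _ [a /= al <-]; exists (cone R k (rot a d)).
  split; first by exists a; rewrite //= size_interlaced_dosp.
  by rewrite cone_interlaced // pot_cone_cell //; apply: has_dim_run_cell.
by rewrite cone_interlaced // pot_cone_cell.
Qed.

Lemma mem_blade y : blade R k d y <->
  exists j i, [/\ (j < l)%N, (i < l)%N, i != j, pot_cone blk k l c j y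
    & f y (b i) = f y (b j)].
Proof.
have surj j : (j < l)%N -> exists a, blk a = j.
  move=> jl; have [p1 _ _ _] := mem_runs (mem_nth ([::], [::]) jl).
  case E: (nth ([::], [::]) CI j).1 p1 => [|a L] // _; exists a.
  by apply/eqP; rewrite mem_block // E mem_head.
split.
  move=> [_ [j /= jl <-]]; rewrite size_interlaced_dosp in jl.
  rewrite cone_interlaced // rel_boundary_pot_cone // => -[cj [i [il ij eqi]]].
  by exists j, i; split=> //; rewrite -!pot_breakpoint ?(ltnW il) ?(ltnW jl).
move=> [j [i [jl il ij cj eqi]]]; exists (cone R k (rot j d)).
  by exists j; rewrite //= size_interlaced_dosp.
rewrite cone_interlaced // rel_boundary_pot_cone //; split=> //.
by exists i; rewrite !pot_breakpoint ?(ltnW il) ?(ltnW jl).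
Qed.

Lemma mem_sigma_blade y : translated_blade sigma (evec R I) y <->
  exists j t, [/\ (j < n)%N, (t < n)%N, t != j, tcone I s j y & f y t = f y j].
Proof.
rewrite -(translated_blade_rot _ _ r) CI_rot.
by apply: mem_translated_blade; rewrite ?unruns_uniq ?unruns_size.
Qed.

Lemma pot_cone_tcone y j : Delta y -> (j < l)%N ->
  pot_cone blk k l c j y <-> tcone I s (b j) y.
Proof.
move=> Dy jl; split=> [cj|tj].
  have : (Delta `&` pot_cone blk k l c j) y by [].
  by rewrite pot_cone_cell // -tcone_cell // => -[].
have : (Delta `&` tcone I s (b j)) y by [].
by rewrite tcone_cell // -pot_cone_cell // => -[].
Qed.

Lemma breakpoint_inj i j : (i < l)%N -> (j < l)%N -> b i = b j -> i = j.
Proof.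
move=> il jl bij; have [ij|ji|//] := ltngtP i j.
  by have := @breakpoint_lt i j; rewrite ij (ltnW jl) bij ltnn => /(_ isT).
by have := @breakpoint_lt j i; rewrite ji (ltnW il) bij ltnn => /(_ isT).
Qed.

Lemma blade_sub_translated :
  blade R k d `&` Delta `<=` translated_blade sigma (evec R I) `&` Delta.
Proof.
move=> y [/mem_blade [j [i [jl il ij cj eqi]]] Dy]; split=> //.
apply/mem_sigma_blade; exists (b j), (b i); split; rewrite ?breakpoint_lt_n //.
  by apply: contra_neq ij => /breakpoint_inj ->.
exact/pot_cone_tcone.
Qed.

(** An index that ties with a minimizer is itself a minimizer. Off the boundary no coordinate is 0
    or 1, so both tied indices are breakpoints. *)
Lemma blade_eq_interior :
  (translated_blade sigma (evec R I) `&` Delta)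
     `\` rel_boundary (hyperplane R n k) Delta
  = (blade R k d `&` Delta) `\` rel_boundary (hyperplane R n k) Delta.
Proof.
apply/seteqP; split=> y; last by move=> [/blade_sub_translated].
move=> [[/mem_sigma_blade [j [t [jn tn tj tcj eqt]]] Dy] nb]; split=> //; split=> //.
have break m : (m < n)%N -> tcone I s m y -> exists2 i, (i < l)%N & m = b i.
  move=> mn tm; apply/not_exists2P => m_nb.
  have [|a [e [e01 ae]]] := @tcone_off_breakpoint m mn.
    by move=> i il mb; case: (m_nb i).
  by apply: nb; apply: rel_boundary_hypersimplex (ae y Dy tm) e01.
have tct : tcone I s t y.
  by split=> [|u un]; [case: tcj | rewrite [leLHS]eqt; apply: tcj.2].
have [j' jl jE] := break j jn tcj; have [i il tE] := break t tn tct.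
apply/mem_blade; exists j', i; rewrite -jE -tE; split=> //.
  by apply: contra_neq tj => ij; rewrite tE jE ij.
by apply/pot_cone_tcone; rewrite -?jE.
Qed.

Lemma interlaced_OSP : OSP k d.
Proof.
pose B (p : seq 'I_n * seq 'I_n) := [set a in p.1 ++ p.2]%SET.
have blocksE : [seq p.1 | p <- d] = [seq B p | p <- CI].
  by rewrite interlaced_dospE -!map_comp.
have B_inj p q a : p \in CI -> q \in CI -> a \in B p -> a \in B q -> p = q.
  by move=> pCI qCI; rewrite !inE; exact: (run_unique unruns_uniq).
have B_0 p : p \in CI -> exists a, a \in B p.
  move=> /mem_runs [+ _ _ _]; rewrite /B; case: p => -[|a L] L' //= _.
  by exists a; rewrite inE mem_head.
split; first split.
- rewrite blocksE map_inj_in_uniq; first exact: runs_uniq unruns_uniq CI_runs.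
  move=> p q pCI qCI BE; have [a ap] := B_0 p pCI.
  by apply: (B_inj p q a) => //; rewrite -BE.
- rewrite blocksE; apply/and3P; split.
  + apply/eqP/setP => a; rewrite [RHS]inE; apply/finset.bigcupP.
    have al := block_lt a; exists (B (nth ([::], [::]) CI (blk a))).
      by rewrite inE; apply: map_f; apply: mem_nth.
    by rewrite inE -mem_block.
  + apply/finset.trivIsetP => S S'; rewrite !inE => /mapP [p pCI ->] /mapP [q qCI ->] BB.
    rewrite -finset.setI_eq0; apply/negPn/negP => /set0Pn [a]; rewrite finset.in_setI.
    by move=> /andP [ap aq]; case/eqP: BB; rewrite (B_inj p q a).
  + rewrite inE; apply/negP => /mapP [p /B_0 [a ap] p0].
    by move: ap; rewrite -p0 inE.
- by rewrite interlaced_dospE big_map; exact: sum_block_weights.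
- move=> _ /mapP [p pCI ->] /=; have [p1 p2 _ _] := mem_runs pCI.
  have -> : ([set i in p.2] :|: [set i in p.1])%SET = B p.
    by apply/setP => a; rewrite !inE mem_cat orbC.
  have up := subseq_uniq (subseq_unruns pCI) unruns_uniq.
  have -> : #|B p| = size (p.1 ++ p.2) by rewrite cardsE (card_uniqP up).
  have -> : #|[set i in p.2]%SET| = size p.2.
    by move: up; rewrite cardsE cat_uniq => /and3P [_ _ /card_uniqP].
  rewrite size_cat; move: p1 p2; rewrite -!size_eq0 -!lt0n.
  move: (size p.1) (size p.2) => x y x_gt0 y_gt0; rewrite PoszD.
  split; lia.
Qed.

End Interlaced.

Theorem theorem17 (R : realType) (n k : nat) (hk : (2 <= k <= n - 2)%N)
    (sigma : n.-tuple 'I_n) (hsigma : uniq sigma)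
    (I : {set 'I_n}) (hI : #|I| = k) :
  let Delta := hypersimplex R n k in
  let H := hyperplane R n k%:Z in
  let l := #|cyclic_intervals sigma I| in
  let B := translated_blade sigma (evec R I) in
  let Sigma := induced_subdivision Delta (translated_cones sigma (evec R I)) in
  [/\ [/\ is_multi_split Delta Sigma,
          is_matroid_subdivision k Sigma
        & (Sigma #= `I_l)%card],
      trivial_subdivision Delta Sigma <-> is_cyclic_interval sigma I,
      exists CI, interlacing sigma I CI
    & forall CI, interlacing sigma I CI ->
        let d := interlaced_dosp CI in
        [/\ size d = l,
            OSP k d,
            Sigma = induced_subdivision Delta (blade_cones R k%:Z d),
            (B `&` Delta) `\` rel_boundary H Delta
              = (blade R k%:Z d `&` Delta) `\` rel_boundary H Delta
          & blade R k%:Z d `&` Delta `<=` B `&` Delta]].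
Proof.
move=> Delta H l B Sigma.
have [k2 kn] := andP hk.
have n_gt1 : (1 < n)%N by lia.
have n_gt0 : (0 < n)%N by lia.
have s_size : size sigma = n by rewrite size_tuple.
have size_CI CI : interlacing sigma I CI -> size CI = l.
  by move=> [_ /perm_size]; rewrite size_map -cardE.
have [r [CI [CI_runs CI_rot]]] : exists r CI, runs I CI /\ rot r sigma = unruns CI.
  apply: rotation_runs.
    have /card_gt0P [a aI] : (0 < #|I|)%N by lia.
    by exists a; rewrite // (mem_full _ hsigma).
  have /card_gt0P [a] : (0 < #|~: I|)%N by have := cardsC I; rewrite card_ord; lia.
  by rewrite inE => aI; exists a; rewrite // (mem_full _ hsigma).
have CI_int : interlacing sigma I CI.
  apply: (runs_interlacing hsigma s_size _ CI_runs CI_rot) => CI0.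
  move: (congr1 size CI_rot); rewrite size_rot s_size CI0 /= => n0.
  by rewrite n0 in n_gt0.
have SigmaE := translated_cells R n_gt1 hsigma s_size hI CI_runs CI_rot.
have bl := block_lt hsigma s_size CI_rot.
have sb := run_size_bounds hsigma CI_runs CI_rot.
have ss := sum_run_sizes hsigma s_size hI CI_runs CI_rot.
have matQ a := @cell_matroid R n k r sigma I CI n_gt1 hsigma s_size hI CI_runs CI_rot a.
have polQ a al := matroid_polytope_polytope (matQ a al).
have sub : is_subdivision Delta Sigma.
  by rewrite /Sigma SigmaE; apply: cells_subdivision.
have card : (Sigma #= `I_l)%card.
  by rewrite /Sigma SigmaE -(size_CI _ CI_int); apply: cells_card.
split.
- split=> //.
  + by exists (size CI); rewrite /Sigma SigmaE; apply: cells_split.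
  + by split=> // Q; rewrite /Sigma SigmaE => -[a al <-]; apply: matQ.
- rewrite /is_cyclic_interval -/l; split=> [triv|l1].
    by apply/card_eq_II; move: card; rewrite triv => /card_eql <-; apply: card_set1.
  rewrite /trivial_subdivision.
  (* A subdivision with a single cell consists of its union, the hypersimplex. *)
  have [Q SigmaQ] : exists Q, Sigma = [set Q].
    have /eq_cardSP [Q SQ] : (Sigma #= `I_1)%card by have := card; rewrite [l]l1.
    rewrite II0 card_eq0 => /eqP SQ0; exists Q.
    apply/seteqP; split=> [Q' SQ'|_ -> //]; apply: contrapT => QQ'.
    by have : (Sigma `\ Q) Q' by []; rewrite SQ0.
  have [_ _ unS _] := sub.
  by rewrite -unS SigmaQ bigcup_set1.
- by exists CI.
- move=> CI' CI'_int d; have CI'_runs := interlacing_runs s_size CI'_int.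
  have [[r' CI'_rot] _ _] := CI'_int.
  split.
  + by rewrite /d size_map size_CI.
  + exact: interlaced_OSP n_gt1 hsigma s_size hI CI'_runs CI'_rot.
  + rewrite /Sigma (translated_cells R n_gt1 hsigma s_size hI CI'_runs CI'_rot).
    by rewrite (blade_cells R n_gt1 hsigma s_size hI CI'_runs CI'_rot).
  + exact: (blade_eq_interior R n_gt1 hsigma s_size hI CI'_runs CI'_rot).
  + exact: (blade_sub_translated n_gt1 hsigma s_size hI CI'_runs CI'_rot).
Qed.
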